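(* Let $I\subseteq\mathbb{R}^{1\times\ell}\langle x,x^*\rangle$ be the left module generated by $\iota_1,\ldots,\iota_\mu\in\mathbb{R}^{1\times\ell}\langle x,x^*\rangle$. The following are true for applying the Real Radical Algorithm (described in the context) to $\iota_1,\ldots,\iota_\mu$. 1. If $\deg(\iota_1),\ldots,\deg(\iota_\mu)\le d$, the polynomials involved in the algorithm all have degree less than $2d$. 2. The algorithm is guaranteed to terminate in a finite number of steps. 3. When the algorithm terminates, it outputs a reduced left Gröbner basis for $\sqrt[\mathrm{rr}]{I}$.
   Context: Basic notation. $\langle x,x^*\rangle$ is the free monoid on the letters $x_1,\ldots,x_g,x_1^*,\ldots,x_g^*$ (empty word $=1$, $|w|$ is the length of $w$), and $\mathbb{R}\langle x,x^*\rangle$ is the free $\mathbb{R}$-algebra it spans, with linear involution exchanging $x_i$ and $x_i^*$ and satisfying $(pq)^*=q^*p^*$. $\mathbb{R}^{\nu\times\ell}\langle x,x^*\rangle=\mathbb{R}^{\nu\times\ell}\otimes\mathbb{R}\langle x,x^*\rangle$ is the space of $\nu\times\ell$ matrices over $\mathbb{R}\langle x,x^*\rangle$, with involution $(\sum_w A_w\otimes w)^*=\sum_wA_w^*\otimes w^*$ ($A^*$ the transpose). A monomial in $\mathbb{R}^{\nu\times\ell}\langle x,x^*\rangle$ is an element $E_{ij}\otimes w$ with $E_{ij}$ a matrix unit and $w$ a word; its degree is $|w|$; $\deg p$ is the largest degree of a monomial appearing in $p$. In $\mathbb{R}^{1\times\ell}\langle x,x^*\rangle$ the monomials are $e_j\otimes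 w$, with $e_j$ the standard row vectors. A monomial $m_2$ divides $m_1$ on the right if $m_1=wm_2$ for some word $w$; properly if $w\ne1$. ''Left module'' means a left $\mathbb{R}\langle x,x^*\rangle$-submodule of $\mathbb{R}^{1\times\ell}\langle x,x^*\rangle$. For sets $A,B$, $AB$ is the linear span of the products $ab$, and $A^*=\{a^*\mid a\in A\}$. A left module $I$ is real if whenever a finite sum $\sum_ip_i^*p_i$ with $p_i\in\mathbb{R}^{1\times\ell}\langle x,x^*\rangle$ lies in $\mathbb{R}^{\ell\times1}I+I^*\mathbb{R}^{1\times\ell}$, each $p_i\in I$. The real radical $\sqrt[\mathrm{rr}]{I}$ is the smallest real left module containing $I$. A sum of squares is a finite sum $\sum_i p_i^*p_i$. Gröbner bases. Fix a degree lexicographic order on the monomials of $\mathbb{R}^{1\times\ell}\langle x,x^*\rangle$ (a well order comparing first by degree, ties broken lexicographically, and compatible with left multiplication by words). $\operatorname{lm}(p)$ is the largest monomial appearing in $p$; $p$ is monic if $\operatorname{lm}(p)$ has coefficient $1$. A subset $\mathcal{G}$ of a left module $I$ is a left Gröbner basis of $I$ if the leading monomials of elements of $\mathcal{G}$ generate the same left module as the leading monomials of elements of $I$. It is reduced if every element is monic and, for distinct $\iota_1,\iota_2\in\mathcal{G}$, $\operatorname{lm}(\iota_1)$ does not divide any term of $\iota_2$ on the right. A reduced left Gröbner basis of the left module generated by a finite set $\mathcal{G}$ is computed as follows: (i) if $0\in\mathcal{G}$, remove it, and scale all elements to be monic; (ii) if for some $\iota_i,\iota_j\in\mathcal{G}$,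 $i\neq j$, $\operatorname{lm}(\iota_i)$ divides a term of $\iota_j$ on the right, let $w$ be a word and $\xi\in\mathbb{R}$ such that $\xi w\operatorname{lm}(\iota_i)$ is a term of $\iota_j$, replace $\iota_j$ by $\iota_j-\xi w\iota_i$ and go back to (i); (iii) otherwise stop and output $\mathcal{G}$. Real Radical Algorithm. (1) Given: $\mathcal{G}=\{\iota_1,\ldots,\iota_\mu\}$. (2) With respect to the fixed degree lexicographic order, compute a reduced left Gröbner basis from $\mathcal{G}$, and let $\mathcal{G}^{(0)}$ be the resulting basis. (3) Let $i=0$. (4) If $\mathcal{G}^{(i)}$ only contains constants, stop and output $\mathcal{G}^{(i)}$. (5) Let $\mathfrak{C}^{(i)}$ be the set of monomials which properly divide a term of any of the polynomials in $\mathcal{G}^{(i)}$ on the right. (6) For each $\vartheta_j\in\mathcal{G}^{(i)}$ let $q_j=\sum_{m\in\mathfrak{C}^{(i)}}\alpha^{(i)}_{m,j}m$, where the $\alpha^{(i)}_{m,j}$ are real-valued variables, and test whether or not the polynomial $P=\sum_{\vartheta_j\in\mathcal{G}^{(i)}}(q_j^*\vartheta_j+\vartheta_j^*q_j)$ is a nonzero sum of squares for some values $\alpha^{(i)}_{m,j}\in\mathbb{R}$, using the following SOS Algorithm: (a) Given: $P$. (b) For each monomial in $P$ which is not in $(\mathfrak{C}^{(i)})^*(\mathfrak{C}^{(i)})$, set the coefficient equal to $0$. Solve the resulting set of linear equations in terms of the $\alpha^{(i)}_{m,j}$ and reduce $P$ to have only terms in $(\mathfrak{C}^{(i)})^*(\mathfrak{C}^{(i)})$.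 (c) Let $M_i$ be a (column) vector whose entries are all monomials in $\mathfrak{C}^{(i)}$. (If desired, one can pick a smaller vector $M_i$ by eliminating monomials of small degree, following Klep and Povh.) (d) Let $\mathcal{Z}^{(i)}$ be the space of real symmetric matrices $Z$ with $M_i^*ZM_i=0$, and let $Z^{(i)}_1,\ldots,Z^{(i)}_{n^{(i)}}$ be a basis for $\mathcal{Z}^{(i)}$. (e) For each $m^*\vartheta_j+\vartheta_j^*m$, let $B^{(i)}_{m,j}$ be a symmetric matrix such that $m^*\vartheta_j+\vartheta_j^*m=M_i^*B^{(i)}_{m,j}M_i$. (f) In the linear pencil $L_i(\alpha^{(i)},\zeta^{(i)})=\sum_{m\in\mathfrak{C}^{(i)}}\sum_{\vartheta_j\in\mathcal{G}^{(i)}}\alpha^{(i)}_{m,j}B^{(i)}_{m,j}+\sum_{k=1}^{n^{(i)}}\zeta^{(i)}_kZ^{(i)}_k$, if there are any diagonal entries which are $0$, set all entries in the corresponding row and column to be $0$, use the resulting linear equations to reduce the problem, and delete the $0$ row and column from $L_i$. Also delete the entry in $M_i$ with the same index as the deleted row and column. Repeat this step until there are no diagonal entries in $L_i$ equal to $0$. (g) If eventually $L_i=0$, stop and output that there is no nonzero sum of squares. (h) Solve the linear matrix inequality $L_i(\alpha^{(i)},\zeta^{(i)})\succeq0$ (positive semidefinite) to see if there is a nonzero solution $(\alpha^{(i)},\zeta^{(i)})$. If there is not, stop and output that there is no nonzero sum of squares. Otherwise, output the vector of polynomials $\sqrt{L_i(\alpha^{(i)},\zeta^{(i)})}\,M_i$.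 (7) If there is no nonzero sum of squares, stop and output $\mathcal{G}^{(i)}$. (8) Otherwise, let $\phi_1,\ldots,\phi_{r_i}$ be the entries of the outputted vector of polynomials. Compute a reduced left Gröbner basis for the set $\mathcal{G}^{(i)}\cup\{\phi_1,\ldots,\phi_{r_i}\}$, let $\mathcal{G}^{(i+1)}$ be the resulting set, and go to step (4) with $i+1$ in place of $i$.
   Formalization: Item 1 is stated for d ≥ 1 (it fails for nonzero constants with d = 0); in step (e) B represents only the part of m*ϑ+ϑ*m lying in the span of M*M, with (b) imposed on α; in step (h) a nonzero solution means one with L ≠ 0, since otherwise the algorithm can loop. *)

(* Defs.v *)
From mathcomp Require Import all_boot all_order all_algebra.
From mathcomp Require Import classical_sets reals.
From mathcomp Require Import finmap multinomials.monalg.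
From Stdlib Require Import Relation_Operators.

Set Implicit Arguments.
Unset Strict Implicit.
Unset Printing Implicit Defensive.

Import Order.TTheory GRing.Theory Num.Theory.

Local Open Scope classical_set_scope.
Local Open Scope ring_scope.

(* [inl i] is the letter x_i and [inr i] is x_i^*. *)
Definition letter (g : nat) : Type := ('I_g + 'I_g)%type.

Notation word g := {fmonom (letter g)}.

(* The free algebra R<x,x^*>. *)
Notation ncpoly R g := {malg R[word g]}.

(* The monomial e_j (x) w of R^{1 x l}<x,x^*>, encoded as (w, j). *)
Notation mono g l := (word g * 'I_l)%type.

Section FreeStarAlgebra.
Context {R : realType} {g : nat}.
Implicit Types (w : word g) (a : ncpoly R g).

Definition letter_star (x : letter g) : letter g :=
  match x with inl i => inr i | inr i => inl i end.

Definition word_star w : word g := FMonom (rev (map letter_star w)).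

Definition poly_star a : ncpoly R g :=
  \sum_(w <- msupp a) << a@_w *g word_star w >>.

Definition adj m n (p : 'M[ncpoly R g]_(m, n)) : 'M[ncpoly R g]_(n, m) :=
  (map_mx poly_star p)^T.

Definition cst m n (B : 'M[R]_(m, n)) : 'M[ncpoly R g]_(m, n) :=
  map_mx (fun c => c%:MP) B.

(* Convention: the zero polynomial has degree 0. *)
Definition deg m n (p : 'M[ncpoly R g]_(m, n)) : nat :=
  \max_(i < m) \max_(j < n) \max_(w <- msupp (p i j)) size w.

(* The real span of the products a b, with a in X and b in Y. *)
Definition mulspan m k n (X : set 'M[ncpoly R g]_(m, k))
    (Y : set 'M[ncpoly R g]_(k, n)) : set 'M[ncpoly R g]_(m, n) :=
  [set p | exists s : seq (R * 'M[ncpoly R g]_(m, k) * 'M[ncpoly R g]_(k, n)),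
     (forall t, t \in s -> X t.1.2 /\ Y t.2) /\
     p = \sum_(t <- s) t.1.1%:MP *: (t.1.2 *m t.2)].

End FreeStarAlgebra.

Section LeftModules.
Context {R : realType} {g l : nat}.
Local Notation row := 'rV[ncpoly R g]_l.
Implicit Types I J : set row.

Definition left_module I : Prop :=
  I 0 /\ forall (a : ncpoly R g) (p q : row), I p -> I q -> I (a *: p + q).

(* R^{l x 1} I + I^* R^{1 x l} *)
Definition real_span I : set 'M[ncpoly R g]_l :=
  [set p | exists u v,
     [/\ mulspan (range (@cst R g l 1)) I u,
         mulspan (@adj R g 1 l @` I) (range (@cst R g 1 l)) v & p = u + v]].

Definition real_module I : Prop :=
  forall ps : seq row, real_span I (\sum_(p <- ps) adj p *m p) ->
    forall p, p \in ps -> I p.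

Definition module_gen (X : set row) : set row := smallest left_module X.

Definition real_radical I : set row :=
  smallest (fun J => left_module J /\ real_module J) I.

End LeftModules.

Section Monomials.
Context {R : realType} {g l : nat}.
Local Notation row := 'rV[ncpoly R g]_l.
Implicit Types (m : mono g l) (p q : row).

Definition mono_vec m : row := << m.1 >> *: delta_mx 0 m.2.

Definition mono_mul (w : word g) m : mono g l := (mmul w m.1, m.2).

Definition rdivides m1 m2 : Prop := exists w, m2 = mono_mul w m1.

Definition coef m p : R := (p 0 m.2)@_(m.1).

Definition supp p : seq (mono g l) :=
  [seq (w, j) | j <- enum 'I_l, w <- msupp (p 0 j)].

End Monomials.

Section DegLex.
Context {g l : nat}.

(* The letters and the e_j are ordered through injective ranks; [first] tells
   whether e_j is compared before or after the word. *)
Definition deglex (rl : letter g -> nat) (rc : 'I_l -> nat) (first : bool)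
    (m1 m2 : mono g l) : bool :=
  let code (m : mono g l) : seqlexi nat :=
    if first then rc m.2 :: map rl m.1 else rcons (map rl m.1) (rc m.2) in
  (size m1.1 < size m2.1)%N ||
  (size m1.1 == size m2.1) && (code m1 <= code m2)%O.

Definition is_deglex (le : rel (mono g l)) : Prop :=
  exists rl rc first, [/\ injective rl, injective rc & le =2 deglex rl rc first].

End DegLex.

Section LeftGroebner.
Context {R : realType} {g l : nat}.
Local Notation row := 'rV[ncpoly R g]_l.
Variable le : rel (mono g l).
Implicit Types (p q : row) (G : seq row) (X J : set row).

Definition lm p : option (mono g l) :=
  ohead (sort (fun m1 m2 => le m2 m1) (supp p)).

Definition lc p : R := if lm p is Some m then coef m p else 0.

Definition lm_set X : set row :=
  [set v | exists p m, [/\ X p, lm p = Some m & v = mono_vec m]].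

Definition left_gb J X : Prop :=
  X `<=` J /\ module_gen (lm_set X) = module_gen (lm_set J).

Definition reduced X : Prop :=
  (forall p, X p -> lc p = 1) /\
  (forall p q m t, X p -> X q -> p <> q -> lm p = Some m -> t \in supp q ->
     ~ rdivides m t).

Definition reduced_left_gb J X : Prop := left_gb J X /\ reduced X.

Definition normalize G : seq row :=
  [seq (lc p)^-1%:MP *: p | p <- G & p != 0].

(* [red] is the multiple xi w iota_i that is subtracted from iota_j. *)
Definition reduction G (j : nat) (red : row) : Prop :=
  exists i m w t,
    [/\ (i < size G)%N, (j < size G)%N, i <> j, lm G`_i = Some m &
     [/\ t \in supp G`_j, t = mono_mul w m &
         red = << coef t G`_j *g w >> *: G`_i]].

End LeftGroebner.

Section RealRadicalAlgorithm.
Context {R : realType} {g l : nat}.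
Local Notation row := 'rV[ncpoly R g]_l.
Local Notation sqr := 'M[ncpoly R g]_l.
Variable le : rel (mono g l).
Implicit Types (G : seq row) (M : seq (mono g l)) (alpha : mono g l -> row -> R).

(* Dividing properly on the right is being obtained by dropping k.+1 letters. *)
Definition proper_divisors (t : mono g l) : seq (mono g l) :=
  [seq (FMonom (drop k.+1 t.1), t.2) | k <- iota 0 (size t.1)].

Definition chips G : seq (mono g l) :=
  undup (flatten [seq flatten (map proper_divisors (supp p)) | p <- G]).

Definition qpoly G alpha (t : row) : row :=
  \sum_(m <- chips G) (alpha m t)%:MP *: mono_vec m.

(* G is duplicate-free here, so its elements can serve as indices. *)
Definition Ppoly G alpha : sqr :=
  \sum_(t <- G) (adj (qpoly G alpha t) *m t + adj t *m qpoly G alpha t).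

(* (i, j, w) stands for the monomial E_ij (x) w of R^{l x l}<x,x^*>. *)
Definition star_products M : seq ('I_l * 'I_l * word g) :=
  [seq (m1.2, m2.2, mmul (word_star m1.1) m2.1) | m1 <- M, m2 <- M].

Definition supported M (p : sqr) : Prop :=
  forall i j w, (i, j, w) \notin star_products M -> (p i j)@_w = 0.

Definition column M : 'M[ncpoly R g]_(size M, l) :=
  \matrix_(k < size M) mono_vec (tnth (in_tuple M) k).

Definition gram M (B : 'M[R]_(size M)) : sqr :=
  adj (column M) *m cst B *m column M.

Record pencil := Pencil {
  gens : seq row;
  monos : seq (mono g l);
  Zs : seq 'M[R]_(size monos);
  Bs : mono g l -> row -> 'M[R]_(size monos)
}.

(* [monos] lists the chips of degree at least delta; delta = 0 is always
   allowed, and delta > 0 is the optional elimination of monomials of small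
   degree, allowed when the remaining ones suffice to represent P. *)
Definition admissible_monos G M : Prop :=
  (exists delta, perm_eq M [seq m : mono g l <- chips G | (delta <= size m.1)%N]) /\
  (forall alpha, supported (chips G) (Ppoly G alpha) ->
     supported M (Ppoly G alpha)).

(* m^* t + t^* m need not lie in the span of M^* M for each single m and t: only
   combinations with suitable alpha do.  So B_{m,t} represents the part of
   m^* t + t^* m supported on M^* M; the vanishing of the remaining part of P is
   the constraint on alpha in [feasible]. *)
Definition valid_pencil (D : pencil) : Prop :=
  [/\ admissible_monos (gens D) (monos D),
      free (Zs D) /\
        (forall Z, Z \in <<Zs D>>%VS <-> Z^T = Z /\ gram Z = 0)
    & forall m t, m \in chips (gens D) -> t \in gens D ->
        (Bs D m t)^T = Bs D m t /\
        forall i j w, (i, j, w) \in star_products (monos D) ->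
          (gram (Bs D m t) i j)@_w =
          ((adj (mono_vec m) *m t + adj t *m mono_vec m) i j)@_w].

Definition Lmx (D : pencil) alpha (zeta : nat -> R) : 'M[R]_(size (monos D)) :=
  \sum_(m <- chips (gens D)) \sum_(t <- gens D) alpha m t *: Bs D m t
  + \sum_(k < size (Zs D)) zeta k *: (Zs D)`_k.

(* The parameters remaining once the rows and columns outside S have been set to
   0 and deleted.  The deleted rows and columns are kept as zero ones. *)
Definition feasible (D : pencil) (S : {set 'I_(size (monos D))}) alpha zeta :
    Prop :=
  supported (chips (gens D)) (Ppoly (gens D) alpha) /\
  forall a b, ~~ ((a \in S) && (b \in S)) -> Lmx D alpha zeta a b = 0.

Definition zero_diag (D : pencil) (S : {set 'I_(size (monos D))}) k : Prop :=
  k \in S /\ forall alpha zeta, feasible S alpha zeta -> Lmx D alpha zeta k k = 0.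

Definition psd n (L : 'M[R]_n) : Prop :=
  L^T = L /\ forall v : 'rV[R]_n, 0 <= (v *m L *m v^T) 0 0.

(* A nonzero solution of the LMI is one at which the pencil is nonzero. *)
Definition lmi_solution (D : pencil) (S : {set 'I_(size (monos D))}) alpha zeta :
    Prop :=
  [/\ feasible S alpha zeta, psd (Lmx D alpha zeta) & Lmx D alpha zeta != 0].

(* [Normalize] and [Interreduce] are the two phases of the computation of a
   reduced Groebner basis, [Facial] is the removal of the zero diagonal entries
   of the pencil followed by the LMI, and [Answer] carries the outcome of the
   search for a nonzero sum of squares. *)
Inductive state : Type :=
| Normalize of seq row
| Interreduce of seq row
| Test of seq row
| Facial D of {set 'I_(size (monos D))}
| Answer of seq row & option (seq row)
| Output of seq row.

Inductive step : state -> state -> Prop :=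
| Step_normalize G :
    step (Normalize G) (Interreduce (normalize le G))
| Step_reduce G j red :
    reduction le G j red ->
    step (Interreduce G) (Normalize (set_nth 0 G j (G`_j - red)))
| Step_reduced G :
    (forall j red, ~ reduction le G j red) ->
    step (Interreduce G) (Test G)
| Step_constant G :
    (forall p, p \in G -> deg p = 0%N) ->
    step (Test G) (Output G)
| Step_pencil D :
    ~ (forall p, p \in gens D -> deg p = 0%N) ->
    valid_pencil D ->
    step (Test (gens D)) (@Facial D [set: 'I_(size (monos D))]%SET)
| Step_delete D (S : {set 'I_(size (monos D))}) k :
    zero_diag S k ->
    step (Facial S) (@Facial D (S :\ k)%SET)
| Step_zero D (S : {set 'I_(size (monos D))}) :
    (forall k, ~ zero_diag S k) ->
    (forall alpha zeta, feasible S alpha zeta -> Lmx D alpha zeta = 0) ->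
    step (Facial S) (Answer (gens D) None)
| Step_nosolution D (S : {set 'I_(size (monos D))}) :
    (forall k, ~ zero_diag S k) ->
    (forall alpha zeta, ~ lmi_solution S alpha zeta) ->
    step (Facial S) (Answer (gens D) None)
| Step_solution D (S : {set 'I_(size (monos D))}) alpha zeta
      (T : 'M[R]_(size (monos D))) :
    (forall k, ~ zero_diag S k) ->
    lmi_solution S alpha zeta ->
    psd T -> T *m T = Lmx D alpha zeta ->
    step (Facial S)
      (Answer (gens D)
         (Some [seq matrix.row k (cst T *m column (monos D)) | k <- enum S]))
| Step_stop G :
    step (Answer G None) (Output G)
| Step_continue G phis :
    step (Answer G (Some phis)) (Normalize (G ++ phis)).

Definition reachable : state -> state -> Prop := clos_refl_trans state step.

Definition basis (s : state) : seq row :=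
  match s with
  | Normalize G | Interreduce G | Test G | Answer G _ | Output G => G
  | Facial D _ => gens D
  end.

(* The polynomials (with arbitrary values for the variables alpha and zeta)
   occurring in the algorithm at a given state. *)
Inductive involved : state -> forall m n, 'M[ncpoly R g]_(m, n) -> Prop :=
| Involved_basis s (p : row) : p \in basis s -> involved s p
| Involved_reduction G j red : reduction le G j red -> involved (Interreduce G) red
| Involved_chip D S m :
    m \in chips (gens D) -> involved (@Facial D S) (mono_vec m : row)
| Involved_q D S alpha t :
    t \in gens D -> involved (@Facial D S) (qpoly (gens D) alpha t)
| Involved_qt D S alpha t :
    t \in gens D -> involved (@Facial D S) (adj (qpoly (gens D) alpha t) *m t)
| Involved_P D S alpha : involved (@Facial D S) (Ppoly (gens D) alpha)
| Involved_gram D S alpha zeta :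
    involved (@Facial D S) (gram (Lmx D alpha zeta))
| Involved_phi G phis (p : row) :
    p \in phis -> involved (Answer G (Some phis)) p.

(* The choices left open by the description make [step] nondeterministic:
   termination is that of all executions, which moreover can only get stuck by
   producing an output. *)
Definition terminates (s0 : state) : Prop :=
  (~ exists run : nat -> state,
       run 0%N = s0 /\ forall k, step (run k) (run k.+1)) /\
  (forall s, reachable s0 s -> (forall s', ~ step s s') ->
     exists G, s = Output G).

End RealRadicalAlgorithm.

(* Main.v *)
(* The reductions are well founded because weighting a monomial by 2 to the power
   of its rank makes every reduction decrease the total weight of the
   basis; the outer loop terminates because each nonzero [phi] is a combination
   of chips, none of which is divisible by a leading monomial, so its leading
   monomial is a new one, of degree at most [d].

   At an output the module [I] of the basis [theta_1, theta_2, ...] is real.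
   If [sum_i p_i^* p_i] lies in [R^(l x 1) I + I^* R^(1 x l)], reduce the [p_i]
   to normal forms [r_i] and write
     [sum_i r_i^* r_i = sum_j (g_j^* theta_j + theta_j^* g_j) + sum_j theta_j^* h_j]
   with [g_j] in normal form and [h_j] in [I] (after doubling the left side to
   symmetrise the right one). The word [lm(theta_j)^* lm(h_j)], for [h_j] of
   largest leading monomial, cannot cancel, so all [h_j] vanish. For a longest
   monomial [m] occurring in some [r_i] or [g_j] without being a chip, comparing
   the coefficients of [m^* lm(theta_j)] shows that [m] does not occur in [g_j],
   and then those of [m^* m] that it does not occur in the [r_i]. Hence all
   [r_i] and [g_j] are combinations of chips, and the sum of squares is a [P]
   of step (6), which the linear matrix inequality rules out unless all
   [r_i = 0]. *)

(* No S-polynomials arise for left modules: the right divisors of a word form a chain, so two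
   leading monomials with a common left multiple divide one another, and a monic interreduced family
   is already a Gröbner basis. Equality with the real radical is a squeeze. During a run the module
   of the basis stays between [I] and its real radical, because the rows [phi] of [sqrt(L) M]
   satisfy [sum phi^* phi = P] and [P] lies in the space that the definition of a real module tests.
   Realness of the module at an output then closes the gap. Deleting rows of the pencil loses no
   solution, since a positive semidefinite matrix with a zero diagonal entry has a zero row there.
   The bound [2d] comes from chips being proper divisors: their degree is at most [d - 1], so
   [q^* theta] has degree at most [2d - 1]. That an execution stops only at an output is a separate
   matter: every choice the algorithm makes must be possible, which requires a basis of the Gram
   kernel, the matrices [B], and square roots of positive semidefinite matrices. *)
Require Import Defs.
From HB Require Import structures.
From mathcomp Require Import all_boot all_order all_algebra.
From mathcomp Require Import boolp classical_sets reals.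
From mathcomp Require Import finmap multinomials.monalg complex zify.

Set Implicit Arguments.
Unset Strict Implicit.
Unset Printing Implicit Defensive.

Import Order.TTheory GRing.Theory Num.Theory.

Local Open Scope classical_set_scope.
Local Open Scope ring_scope.

(** * Words and monomials *)

Section Words.
Context {g : nat}.
Implicit Types u v w : word g.

Lemma mmul_cat u v : mmul u v = u ++ v :> seq (letter g).
Proof. by rewrite [mmul u v]fmmulE. Qed.

Lemma size_mmul u v : size (mmul u v) = (size u + size v)%N.
Proof. by rewrite mmul_cat size_cat. Qed.

Lemma word_inj : injective (@fmonom_val (letter g)).
Proof. exact: val_inj. Qed.

Lemma letter_starK : involutive (@letter_star g).
Proof. by case. Qed.

Lemma word_starK : involutive (@word_star g).
Proof.
move=> w; apply: word_inj; rewrite /word_star /= map_rev revK -map_comp.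
by rewrite (eq_map (g := id)) ?map_id // => x /=; rewrite letter_starK.
Qed.

Lemma size_word_star w : size (word_star w) = size w.
Proof. by rewrite /word_star /= size_rev size_map. Qed.

Lemma word_starM u v : word_star (mmul u v) = mmul (word_star v) (word_star u).
Proof.
apply: word_inj; rewrite mmul_cat /word_star /=.
by rewrite -rev_cat -map_cat mmul_cat.
Qed.

Lemma mone_nil : (one : word g) = FMonom [::].
Proof. by apply: word_inj; rewrite fm1. Qed.

Lemma word_star1 : word_star one = one :> word g.
Proof. by rewrite mone_nil; apply: word_inj. Qed.

Lemma size_word_eq0 w : (size w == 0%N) = (w == one).
Proof. by rewrite size_eq0 mone_nil; apply/eqP/eqP => [e|->//]; apply: word_inj. Qed.

Lemma mmulI u : injective (mmul u).
Proof.
move=> v w /(congr1 (@fmonom_val _)); rewrite !mmul_cat => /eqP.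
by rewrite eqseq_cat // eqxx => /eqP /word_inj.
Qed.

Lemma mmulIr u v w : mmul v u = mmul w u -> v = w.
Proof.
move=> /(congr1 (@fmonom_val _)); rewrite !mmul_cat => /eqP e.
have sz : size v = size w.
  by move/eqP/(congr1 size): e; rewrite !size_cat => /eqP; rewrite eqn_add2r => /eqP.
by move: e; rewrite eqseq_cat // => /andP[/eqP /word_inj].
Qed.

Lemma mmul_levi u v u' v' : mmul u v = mmul u' v' -> (size u <= size u')%N ->
  exists s, u' = mmul u s /\ v = mmul s v'.
Proof.
move=> /(congr1 (@fmonom_val _)); rewrite !mmul_cat => e le.
have eu : u = take (size u) u' :> seq _.
  by move: (congr1 (take (size u)) e); rewrite take_size_cat // takel_cat.
exists (FMonom (drop (size u) u')); split; apply: word_inj; rewrite mmul_cat /=.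
  by rewrite -[LHS](cat_take_drop (size u)) -eu.
move: (congr1 (drop (size u)) e); rewrite drop_size_cat // drop_cat.
move: le; rewrite leq_eqVlt => /orP[/eqP ->|->//].
by rewrite ltnn subnn drop0 drop_size.
Qed.

End Words.

Section Monos.
Context {g l : nat}.
Implicit Types (m a b : mono g l) (u v w : word g).

Lemma mono_mul1 m : mono_mul one m = m.
Proof. by case: m => w j; rewrite /mono_mul /= mul1m. Qed.

Lemma mono_mulA u v m : mono_mul u (mono_mul v m) = mono_mul (mmul u v) m.
Proof. by rewrite /mono_mul /= mulmA. Qed.

Lemma size_mono_mul u m : size (mono_mul u m).1 = (size u + size m.1)%N.
Proof. exact: size_mmul. Qed.

Lemma mono_mulI u : injective (@mono_mul g l u).
Proof. by move=> [a i] [b j] [/mmulI -> ->]. Qed.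

Lemma rdivides_refl m : rdivides m m.
Proof. by exists one; rewrite mono_mul1. Qed.

Lemma rdivides_mul u m m' : rdivides m m' -> rdivides m (mono_mul u m').
Proof. by case=> s ->; exists (mmul u s); rewrite mono_mulA. Qed.

Lemma rdivides_trans m1 m2 m3 : rdivides m1 m2 -> rdivides m2 m3 -> rdivides m1 m3.
Proof. by move=> h [s ->]; apply: rdivides_mul. Qed.

Lemma rdivides_size m1 m2 : rdivides m1 m2 -> (size m1.1 <= size m2.1)%N.
Proof. by case=> s ->; rewrite size_mono_mul leq_addl. Qed.

Lemma rdivides_eq m1 m2 : rdivides m1 m2 -> (size m2.1 <= size m1.1)%N -> m1 = m2.
Proof.
case=> s -> ; rewrite size_mono_mul -[X in (_ <= X)%N]add0n leq_add2r leqn0.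
by rewrite size_word_eq0 => /eqP ->; rewrite mono_mul1.
Qed.

(** Both are suffixes of one word, and the suffixes of a word are nested. *)
Lemma mono_mul_comparable u v m1 m2 : mono_mul u m1 = mono_mul v m2 ->
  rdivides m1 m2 \/ rdivides m2 m1.
Proof.
case: m1 m2 => [a i] [b j] [e <-].
case/orP: (leq_total (size u) (size v)) => le.
  by have [s [_ ->]] := mmul_levi e le; right; exists s.
by have [s [_ ->]] := mmul_levi (esym e) le; left; exists s.
Qed.

(* The word of the monomial [a^* b], whose matrix unit is [E_(a.2, b.2)]. *)
Definition sprod (a b : mono g l) : word g := mmul (word_star a.1) b.1.

(** Levi's lemma: the letters by which [a'^*] reaches further than [a^*] into the common word form a
    prefix of [b]. Starred, they become a left factor of [a']. *)
Lemma sprod_levi a b a' b' : sprod a b = sprod a' b' -> a.2 = a'.2 -> b.2 = b'.2 ->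
  (size a.1 <= size a'.1)%N ->
  exists s, a' = mono_mul (word_star s) a /\ b = mono_mul s b'.
Proof.
move: a b a' b' => [a i] [b j] [a' i'] [b' j'] /= e <- <- le.
have [|s [e1 e2]] := mmul_levi e; first by rewrite !size_word_star.
move: e1 e2 => /= e1 ->; exists s; split=> //.
by rewrite /mono_mul /= -(word_starK a') e1 word_starM word_starK.
Qed.

Lemma size_sprod a b : size (sprod a b) = (size a.1 + size b.1)%N.
Proof. by rewrite size_mmul size_word_star. Qed.

Lemma sprod_star a b : word_star (sprod a b) = sprod b a.
Proof. by rewrite /sprod word_starM word_starK. Qed.

Lemma mem_proper_divisors m t :
  reflect (exists2 s, s <> one & t = mono_mul s m) (m \in proper_divisors t).
Proof.
apply: (iffP mapP) => [[k]|[s s1 ->]].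
  rewrite mem_iota /= add0n => lt ->.
  exists (FMonom (take k.+1 t.1)).
    move=> /(congr1 (@fmonom_val _ )); rewrite fm1 /= => /(congr1 size).
    by rewrite size_take; case: ifP => //= _ e; move: lt; rewrite e.
  by case: t lt => w j /= _; congr pair; apply: word_inj; rewrite mmul_cat /= cat_take_drop.
have sz : (0 < size s)%N by rewrite lt0n size_word_eq0; apply/eqP.
exists (size s).-1.
  by rewrite mem_iota /= add0n prednK // size_mmul leq_addr.
by case: m => w j; congr pair; apply: word_inj; rewrite /= prednK // mmul_cat drop_size_cat.
Qed.

End Monos.

(** * The involution *)

Section PolyStar.
Context {R : realType} {g : nat}.
Implicit Types (a b : ncpoly R g) (w : word g).

Lemma poly_starE a w : (poly_star a)@_w = a@_(word_star w).
Proof.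
rewrite /poly_star raddf_sum /=.
under eq_bigr => v _ do rewrite mcoeffU (can2_eq (@word_starK g) (@word_starK g)).
have [h|h] := msuppP a (word_star w).
  rewrite (big_fsetD1 _ h) /= eqxx mulr1n big_seq big1 ?addr0 // => v.
  by rewrite !inE => /andP[/negbTE ->].
by rewrite big_seq big1 // => v hv; case: eqP hv h => // -> ->.
Qed.

Lemma mem_msupp_star a w : (w \in msupp (poly_star a)) = (word_star w \in msupp a).
Proof. by rewrite -!mcoeff_neq0 poly_starE. Qed.

Lemma poly_star_is_additive : additive (@poly_star R g).
Proof.
move=> a b; apply/malgP => w; apply: etrans (poly_starE _ _) _.
by rewrite !mcoeffB; apply: congr2; [|congr (- _)]; apply/esym/poly_starE.
Qed.


HB.instance Definition _ := GRing.isAdditive.Build (ncpoly R g) (ncpoly R g)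
  (@poly_star R g) poly_star_is_additive.

Lemma poly_starK : involutive (@poly_star R g).
Proof. by move=> a; apply/malgP => w; rewrite !poly_starE word_starK. Qed.

Lemma poly_starU (c : R) w : poly_star << c *g w >> = << c *g word_star w >> :> ncpoly R g.
Proof.
apply/malgP => v; rewrite poly_starE !mcoeffU.
by rewrite (can2_eq (@word_starK g) (@word_starK g)).
Qed.

Lemma poly_starC (c : R) : poly_star c%:MP = c%:MP :> ncpoly R g.
Proof. by rewrite poly_starU word_star1. Qed.

Lemma malgUM (c1 c2 : R) w1 w2 :
  << c1 *g w1 >> * << c2 *g w2 >> = << c1 * c2 *g mmul w1 w2 >> :> ncpoly R g.
Proof. exact: fgmulUU. Qed.

Lemma poly_starMU (c : R) u b :
  poly_star (<< c *g u >> * b) = poly_star b * << c *g word_star u >>.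
Proof.
rewrite (monalgE b) mulr_sumr (raddf_sum (@poly_star R g)) (raddf_sum (@poly_star R g)).
rewrite mulr_suml; apply: eq_bigr => v _.
apply: etrans (congr1 _ (malgUM _ _ _ _)) _; apply: etrans (poly_starU _ _) _.
apply/esym; apply: etrans (congr2 _ (poly_starU _ _) erefl) _.
by apply: etrans (malgUM _ _ _ _) _; rewrite word_starM mulrC.
Qed.

Lemma poly_starM a b : poly_star (a * b) = poly_star b * poly_star a.
Proof.
rewrite (monalgE a) mulr_suml (raddf_sum (@poly_star R g)) (raddf_sum (@poly_star R g)).
rewrite mulr_sumr; apply: eq_bigr => u _.
apply: etrans (poly_starMU _ _ _) _.
exact: (congr2 _ erefl (esym (poly_starU _ _))).
Qed.

Lemma malgCC (c : R) a : c%:MP * a = a * c%:MP.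
Proof.
rewrite (monalgE a) mulr_suml mulr_sumr; apply: eq_bigr => w _.
by rewrite !malgUM mul1m mulm1 mulrC.
Qed.

Lemma mcoeffMU c u v a : (<< c *g u >> * a)@_(mmul u v) = c * a@_v.
Proof.
rewrite {1}(monalgE a) mulr_sumr raddf_sum /=.
under eq_bigr => w _ do rewrite malgUM mcoeffU (inj_eq (@mmulI g u)).
have [h|h] := msuppP a v.
  rewrite (big_fsetD1 _ h) /= eqxx mulr1n big_seq big1 ?addr0 // => w.
  by rewrite !inE => /andP[/negbTE ->].
by rewrite mulr0 big_seq big1 // => w hw; case: eqP hw h => // -> ->.
Qed.

Lemma mcoeffM0 a b w :
  (forall u v, u \in msupp a -> v \in msupp b -> mmul u v <> w) -> (a * b)@_w = 0.
Proof.
move=> h; apply/eqP; rewrite mcoeff_eq0; apply/negP.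
by move=> /msuppM_le [u [v [hu hv e]]]; apply: (h u v).
Qed.

(** Split off the term of [a] at [u]. The rest of [a] does not produce the word [u v], and after [u]
    the right factor is fixed by cancellation. *)
Lemma mcoeffM1 a b u v :
  (forall u' v', u' \in msupp a -> v' \in msupp b -> mmul u' v' = mmul u v -> u' = u) ->
  (a * b)@_(mmul u v) = a@_u * b@_v.
Proof.
move=> h; have : (a - << a@_u *g u >>)@_u = 0 by rewrite mcoeffB mcoeffUU subrr.
have sub u' : u' != u -> (a - << a@_u *g u >>)@_u' = a@_u'.
  by move=> /negbTE ne; rewrite mcoeffB mcoeffU eq_sym ne mulr0n subr0.
have e1 : (a * b)@_(mmul u v) = ((a - << a@_u *g u >>) * b)@_(mmul u v)
                              + (<< a@_u *g u >> * b)@_(mmul u v).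
  by rewrite -mcoeffD -mulrDl subrK.
move: (a - _) sub e1 => a0 sub e1 a0u.
apply: (etrans e1); apply: etrans (congr2 +%R (mcoeffM0 _) (mcoeffMU _ _ _ _)) (add0r _).
move=> u' v' hu hv e.
case: (eqVneq u' u) hu => [->|ne]; first by rewrite -mcoeff_neq0 a0u eqxx.
rewrite -mcoeff_neq0 sub // mcoeff_neq0 => hu.
by case/eqP: ne; apply: h hu hv e.
Qed.

End PolyStar.

Section Adjoint.
Context {R : realType} {g : nat}.
Local Notation A := (ncpoly R g).

Lemma adjE m n (p : 'M[A]_(m, n)) i j : adj p i j = poly_star (p j i).
Proof. by rewrite !mxE. Qed.

Lemma adjK m n (p : 'M[A]_(m, n)) : adj (adj p) = p.
Proof. by apply/matrixP => i j; rewrite !adjE poly_starK. Qed.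

Lemma adj_is_additive m n : additive (@adj R g m n).
Proof. by move=> p q; apply/matrixP => i j; rewrite !(adjE, mxE) raddfB. Qed.

HB.instance Definition _ m n := GRing.isAdditive.Build 'M[A]_(m, n) 'M[A]_(n, m)
  (@adj R g m n) (@adj_is_additive m n).

Lemma adj0 m n : adj (0 : 'M[A]_(m, n)) = 0.
Proof. exact: raddf0. Qed.

Lemma adjD m n (p q : 'M[A]_(m, n)) : adj (p + q) = adj p + adj q.
Proof. exact: raddfD. Qed.

Lemma adjN m n (p : 'M[A]_(m, n)) : adj (- p) = - adj p.
Proof. exact: raddfN. Qed.

Lemma adj_sum m n (I : Type) (r : seq I) (P : pred I) (F : I -> 'M[A]_(m, n)) :
  adj (\sum_(i <- r | P i) F i) = \sum_(i <- r | P i) adj (F i).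
Proof. exact: raddf_sum. Qed.

Lemma adjM m k n (p : 'M[A]_(m, k)) (q : 'M[A]_(k, n)) :
  adj (p *m q) = adj q *m adj p.
Proof.
apply/matrixP => i j; rewrite adjE !mxE raddf_sum; apply: eq_bigr => h _ /=.
by rewrite poly_starM !adjE.
Qed.

Lemma adj_scalar (a : A) n : adj (a%:M : 'M[A]_n) = (poly_star a)%:M.
Proof. by apply/matrixP => i j; rewrite adjE !mxE eq_sym raddfMn. Qed.

Lemma adj_cst m n (B : 'M[R]_(m, n)) : adj (cst B : 'M[A]_(m, n)) = cst B^T.
Proof. by apply/matrixP => i j; rewrite adjE !mxE poly_starC. Qed.

Lemma adjZl m n (a : A) (p : 'M[A]_(m, n)) : adj (a *: p) = adj p *m (poly_star a)%:M.
Proof. by rewrite -mul_scalar_mx adjM adj_scalar. Qed.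

Lemma adjZC m n (c : R) (p : 'M[A]_(m, n)) : adj (c%:MP *: p) = c%:MP *: adj p.
Proof.
by apply/matrixP => i j; rewrite !(adjE, mxE) poly_starM poly_starC malgCC.
Qed.

Lemma scaleCAr m k n (c : R) (p : 'M[A]_(m, k)) (q : 'M[A]_(k, n)) :
  p *m (c%:MP *: q) = c%:MP *: (p *m q).
Proof.
apply/matrixP => i j; rewrite !mxE mulr_sumr; apply: eq_bigr => h _.
by rewrite !mxE mulrA -malgCC mulrA.
Qed.

End Adjoint.

(** * Coefficients and supports of rows, and of products of a row with an adjoint *)

Section Coefficients.
Context {R : realType} {g l : nat}.
Local Notation row := 'rV[ncpoly R g]_l.
Implicit Types (p q : row) (m a b : mono g l) (u w : word g) (c : R).

Lemma coef_is_additive m : additive (@coef R g l m).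
Proof. by move=> p q; rewrite /coef !mxE mcoeffB. Qed.

HB.instance Definition _ m := GRing.isAdditive.Build row R
  (@coef R g l m) (coef_is_additive m).

Lemma rcoefB m p q : coef m (p - q) = coef m p - coef m q.
Proof. exact: raddfB. Qed.

Lemma rcoefZ m c p : coef m (c%:MP *: p) = c * coef m p.
Proof. by rewrite /coef !mxE mcoeffCM. Qed.

Lemma rowP_coef p q : (forall m, coef m p = coef m q) -> p = q.
Proof. by move=> h; apply/rowP => j; apply/malgP => w; apply: (h (w, j)). Qed.

Lemma mem_supp m p : (m \in supp p) = (coef m p != 0).
Proof.
rewrite /coef mcoeff_neq0; apply/allpairsPdep/idP => [[j [w [_ h ->]]]//|h].
by exists m.2, m.1; rewrite mem_enum; split=> //; case: (m).
Qed.

Lemma supp_uniq p : uniq (supp p).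
Proof.
apply: allpairs_uniq_dep; rewrite ?enum_uniq // => [[i u] [j v]] _ _ /=.
by case=> -> ->.
Qed.

Lemma coef_notin m p : m \notin supp p -> coef m p = 0.
Proof. by rewrite mem_supp negbK => /eqP. Qed.

Lemma supp0 : supp (0 : row) = [::].
Proof.
by case e: supp => [//|m s]; have := mem_head m s; rewrite -e mem_supp raddf0 eqxx.
Qed.

Lemma supp_eq0 p : (supp p == [::]) = (p == 0).
Proof.
apply/eqP/eqP => [e|->]; last exact: supp0.
by apply: rowP_coef => m; rewrite raddf0 coef_notin // e.
Qed.

Lemma suppD m p q : m \in supp (p + q) -> m \in supp p \/ m \in supp q.
Proof.
rewrite !mem_supp raddfD /=; case: (eqVneq (coef m p) 0) => [->|]; last by left.
by rewrite add0r; right.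
Qed.

Lemma suppN p : supp (- p) =i supp p.
Proof. by move=> m; rewrite !mem_supp raddfN oppr_eq0. Qed.

Lemma suppB m p q : m \in supp (p - q) -> m \in supp p \/ m \in supp q.
Proof. by move=> /suppD; rewrite suppN. Qed.

Lemma suppZC m c p : m \in supp (c%:MP *: p) -> m \in supp p.
Proof. by rewrite !mem_supp rcoefZ; apply: contraNneq => ->; rewrite mulr0. Qed.

Lemma suppZC_neq0 m c p : c != 0 -> (m \in supp (c%:MP *: p)) = (m \in supp p).
Proof. by move=> c0; rewrite !mem_supp rcoefZ mulf_eq0 (negbTE c0). Qed.

Lemma supp_sum (I : Type) (r : seq I) (P : pred I) (F : I -> row) m :
  m \in supp (\sum_(i <- r | P i) F i) -> exists2 i, P i & m \in supp (F i).
Proof.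
elim/big_rec: _ => [|i x Pi ih]; first by rewrite supp0.
by case/suppD => [h|/ih//]; exists i.
Qed.

Lemma supp_sum_seq (I : eqType) (r : seq I) (F : I -> row) m :
  m \in supp (\sum_(i <- r) F i) -> exists2 i, i \in r & m \in supp (F i).
Proof. by rewrite big_seq => /supp_sum. Qed.

Lemma suppZ m (a : ncpoly R g) p : m \in supp (a *: p) ->
  exists u t, [/\ u \in msupp a, t \in supp p & m = mono_mul u t].
Proof.
rewrite mem_supp /coef mxE mcoeff_neq0 => /msuppM_le [u [v [hu hv e]]].
exists u, (v, m.2); split=> //; first by rewrite mem_supp /coef mcoeff_neq0.
by rewrite /mono_mul /= -e; case: (m).
Qed.

Lemma suppZU m c u p : m \in supp (<< c *g u >> *: p) ->
  exists2 t, t \in supp p & m = mono_mul u t.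
Proof.
case/suppZ => v [t [hv ht ->]]; exists t => //.
by move: hv; rewrite msuppU; case: ifP => // _; rewrite !inE => /eqP ->.
Qed.

Lemma rcoefZU m c u p : coef (mono_mul u m) (<< c *g u >> *: p) = c * coef m p.
Proof. by rewrite /coef !mxE mcoeffMU. Qed.

Lemma coef_mono m m' : coef m (mono_vec m' : row) = (m' == m)%:R.
Proof.
case: m m' => [w j] [w' j']; rewrite /coef /mono_vec !mxE eqxx /= (eq_sym j) xpair_eqE.
case: (j' == j); first by rewrite mulr1 mcoeffU andbT.
by rewrite mulr0 mcoeff0 andbF.
Qed.

Lemma supp_mono m m' : (m \in supp (mono_vec m' : row)) = (m == m').
Proof. by rewrite mem_supp coef_mono pnatr_eq0 eqb0 negbK eq_sym. Qed.

Lemma mono_vec_sum p : p = \sum_(m <- supp p) (coef m p)%:MP *: mono_vec m.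
Proof.
apply: rowP_coef => m; rewrite raddf_sum /=.
under eq_bigr => m' _ do rewrite rcoefZ coef_mono.
have [h|h] := boolP (m \in supp p).
  rewrite (bigD1_seq m) ?supp_uniq //= eqxx mulr1 big1 ?addr0 // => m' /negbTE ->.
  by rewrite mulr0.
rewrite coef_notin // big_seq big1 // => m' hm'.
by case: eqP hm' h => [-> ->//|]; rewrite mulr0.
Qed.

Lemma mono_vecZ c u m :
  << c *g u >> *: (mono_vec m : row) = c%:MP *: mono_vec (mono_mul u m).
Proof.
have e : << c *g u >> * << m.1 >> = c%:MP * << mmul u m.1 >> :> ncpoly R g.
  by apply: etrans (malgUM _ _ _ _) (esym (etrans (malgUM _ _ _ _) _)); rewrite mul1m.
rewrite /mono_vec (scalerA << c *g u >>) (scalerA c%:MP).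
exact: (congr1 (fun a : ncpoly R g => a *: (delta_mx 0 m.2 : row)) e).
Qed.

(* The coefficient of [a^* b] in X. *)
Definition scoef a b (X : 'M[ncpoly R g]_l) : R := (X a.2 b.2)@_(sprod a b).

Lemma scoef_is_additive a b : additive (scoef a b).
Proof. by move=> X Y; rewrite /scoef !mxE mcoeffB. Qed.

HB.instance Definition _ a b := GRing.isAdditive.Build 'M[ncpoly R g]_l R
  (scoef a b) (scoef_is_additive a b).

Lemma scoef_adj a b X : scoef a b (adj X) = scoef b a X.
Proof. by rewrite /scoef adjE poly_starE sprod_star. Qed.

Lemma adjmulE p q i j : (adj p *m q) i j = poly_star (p 0 i) * q 0 j.
Proof. by rewrite mxE big_ord1 adjE. Qed.

Lemma coef_adjmul0 p q i j w :
  (forall a b, a \in supp p -> b \in supp q -> a.2 = i -> b.2 = j -> sprod a b <> w) ->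
  ((adj p *m q) i j)@_w = 0.
Proof.
move=> h; rewrite adjmulE; apply: mcoeffM0 => u v.
rewrite mem_msupp_star -!mcoeff_neq0 => hu hv.
by have := h (word_star u, i) (v, j); rewrite !mem_supp /sprod /= word_starK; apply.
Qed.

Lemma scoef_adjmul0 p q a b :
  (forall a' b', a' \in supp p -> b' \in supp q -> a'.2 = a.2 -> b'.2 = b.2 ->
    sprod a' b' <> sprod a b) ->
  scoef a b (adj p *m q) = 0.
Proof. exact: coef_adjmul0. Qed.

Lemma scoef_adjmul1 p q a b :
  (forall a' b', a' \in supp p -> b' \in supp q -> a'.2 = a.2 -> b'.2 = b.2 ->
    sprod a' b' = sprod a b -> a' = a) ->
  scoef a b (adj p *m q) = coef a p * coef b q.
Proof.
move=> h; rewrite /scoef adjmulE /sprod mcoeffM1.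
  by rewrite poly_starE word_starK.
move=> u v; rewrite mem_msupp_star -!mcoeff_neq0 => hu hv e.
have := h (word_star u, a.2) (v, b.2).
rewrite !mem_supp /sprod /= word_starK => /(_ hu hv erefl erefl e) => e1.
by rewrite -[u]word_starK; congr word_star; case: (a) e1 => ? ? [].
Qed.

End Coefficients.

(** * Degree lexicographic orders *)

Lemma count_lt (T : eqType) (P Q : pred T) (s : seq T) x :
  (forall y, P y -> Q y) -> x \in s -> Q x -> ~~ P x -> (count P s < count Q s)%N.
Proof.
move=> PQ; elim: s => //= y s ih; rewrite inE => /predU1P[->|xs] Qx Px.
  by rewrite Qx (negbTE Px) add0n add1n ltnS sub_count.
rewrite -addnS leq_add ?ih //.
by case: (P y) (PQ y) => // ->.
Qed.

Section MonosUpto.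
Context {g l : nat}.

Definition monos_upto (d : nat) : seq (mono g l) :=
  [seq (w, j) | w <- flatten [seq [seq FMonom (tval t : seq (letter g))
                 | t <- enum {: k.-tuple ('I_g + 'I_g)%type}] | k <- iota 0 d.+1],
                j <- enum 'I_l].

Lemma mem_monos_upto d (m : mono g l) : (size m.1 <= d)%N -> m \in monos_upto d.
Proof.
case: m => w j /= sz; apply/allpairsP; exists (w, j); split; rewrite ?mem_enum //.
apply/flattenP; eexists; first by apply/mapP; exists (size w); rewrite ?mem_iota ?ltnS.
apply/mapP; exists (in_tuple (w : seq ('I_g + 'I_g)%type)); rewrite ?mem_enum //.
by case: w {sz}.
Qed.

End MonosUpto.

Lemma lexi_cat (s s1 s2 : seq nat) :
  (s ++ s1 <= s ++ s2 :> seqlexi nat)%O = (s1 <= s2 :> seqlexi nat)%O.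
Proof. by elim: s => //= x s ih; rewrite Order.SeqLexiOrder.lexi_cons lexx. Qed.

Section DegLexTheory.
Context {g l : nat}.
Variable le : rel (mono g l).
Hypothesis hle : is_deglex le.
Implicit Types m : mono g l.

Let code (rl : letter g -> nat) (rc : 'I_l -> nat) (first : bool) m : seqlexi nat :=
  if first then rc m.2 :: map rl m.1 else rcons (map rl m.1) (rc m.2).

Let code_inj rl rc first : injective rl -> injective rc ->
  injective (code rl rc first).
Proof.
move=> irl irc [w i] [v j]; rewrite /code; case: first => /=.
  by move=> [/irc -> /(inj_map irl) /word_inj ->].
by move=> /eqP; rewrite eqseq_rcons => /andP[/eqP /(inj_map irl) /word_inj -> /eqP /irc ->].
Qed.

Lemma deglex_total : total le.
Proof.
have [rl [rc [first [_ _ e]]]] := hle; move=> m1 m2; rewrite !e /deglex.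
by case: (ltngtP (size m1.1) (size m2.1)) => //= _; apply: le_total.
Qed.

Lemma deglex_refl : reflexive le.
Proof. by move=> m; have := deglex_total m m; rewrite orbb. Qed.

Lemma deglex_size m1 m2 : le m1 m2 -> (size m1.1 <= size m2.1)%N.
Proof.
have [rl [rc [first [_ _ e]]]] := hle; rewrite e /deglex.
by case/orP => [/ltnW//|/andP[/eqP -> _]].
Qed.

Lemma deglex_anti : antisymmetric le.
Proof.
have [rl [rc [first [irl irc e]]]] := hle; move=> m1 m2; rewrite !e /deglex.
case: (ltngtP (size m1.1) (size m2.1)) => //= _ h.
exact: (@code_inj rl rc first irl irc _ _ (le_anti h)).
Qed.

Lemma deglex_trans : transitive le.
Proof.
have [rl [rc [first [irl irc e]]]] := hle; move=> m2 m1 m3; rewrite !e /deglex.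
case: (ltngtP (size m1.1) (size m2.1)) => //= [lt12 _|e12 c12].
  by move=> /orP[/(ltn_trans lt12) ->//|/andP[/eqP <- _]]; rewrite lt12.
rewrite e12; case: (ltngtP (size m2.1) (size m3.1)) => //= _.
exact: le_trans c12.
Qed.

Lemma deglex_mul u m1 m2 : le m1 m2 -> le (mono_mul u m1) (mono_mul u m2).
Proof.
have [rl [rc [first [irl irc e]]]] := hle; rewrite !e /deglex /=.
rewrite !size_mmul ltn_add2l eqn_add2l => /orP[-> //|/andP[-> c]].
apply/orP; right; rewrite !mmul_cat !map_cat /=; case: first c {e} => //.
  by rewrite !Order.SeqLexiOrder.lexi_cons lexi_cat.
by rewrite !rcons_cat lexi_cat.
Qed.

Definition mlt m1 m2 := le m1 m2 && (m1 != m2).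

Lemma mlt_le m1 m2 : mlt m1 m2 -> le m1 m2.
Proof. by case/andP. Qed.

Lemma mltNge m1 m2 : mlt m1 m2 = ~~ le m2 m1.
Proof.
rewrite /mlt; case: (eqVneq m1 m2) => [->|ne]; first by rewrite andbF deglex_refl.
rewrite andbT; apply/idP/negP => [h1 h2|].
  by case/eqP: ne; apply: deglex_anti; rewrite h1 h2.
by move=> h; have := deglex_total m1 m2; case: (le m1 m2) => //= h'; case: h.
Qed.

Lemma mlt_le_trans m1 m2 m3 : mlt m1 m2 -> le m2 m3 -> mlt m1 m3.
Proof. by rewrite !mltNge => h12 h23; apply: contra h12; apply: deglex_trans. Qed.

(** Position of [m] among the finitely many monomials of degree at most [d]. It reduces
    well-foundedness to induction on [nat] and later serves as the exponent in the weight of a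
    row. *)
Definition mrank (d : nat) m := count (mlt^~ m) (monos_upto d).

Lemma mrank_lt d m1 m2 : (size m1.1 <= d)%N -> mlt m1 m2 -> (mrank d m1 < mrank d m2)%N.
Proof.
move=> sz lt; apply: (@count_lt _ _ _ _ m1) => //; last by rewrite /mlt eqxx andbF.
  by move=> y h; apply: mlt_le_trans h (mlt_le lt).
exact: mem_monos_upto.
Qed.

Lemma mrank_inj d m1 m2 : (size m1.1 <= d)%N -> (size m2.1 <= d)%N ->
  mrank d m1 = mrank d m2 -> m1 = m2.
Proof.
move=> s1 s2 e; apply: deglex_anti.
have [h|] := boolP (le m1 m2); last first.
  by rewrite -mltNge => /(mrank_lt s2); rewrite e ltnn.
have [//|] := boolP (le m2 m1).
by rewrite -mltNge => /(mrank_lt s1); rewrite e ltnn.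
Qed.

(** Everything below [m] has at most the degree of [m], so the rank among the monomials of that
    bounded degree decreases. *)
Lemma deglex_ind (P : mono g l -> Prop) :
  (forall m, (forall m', mlt m' m -> P m') -> P m) -> forall m, P m.
Proof.
move=> ih m; have: (size m.1 <= size m.1)%N by [].
move: {2}(size m.1) => d; have [n] := ubnP (mrank d m).
elim: n m => // n IH m lt sz; apply: ih => m' h.
have sz' : (size m'.1 <= d)%N by apply: leq_trans (deglex_size (mlt_le h)) sz.
by apply: IH => //; apply: leq_trans (mrank_lt sz' h) _; rewrite -ltnS.
Qed.

Lemma deglex_max (s : seq (mono g l)) : s != [::] ->
  exists2 m, m \in s & forall t, t \in s -> le t m.
Proof.
elim: s => // x [|y s] ih _.
  by exists x => [|t]; rewrite ?inE // => /eqP ->; apply: deglex_refl.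
have [//|m hm mmax] := ih; have [h|] := boolP (le x m).
  by exists m => [|t]; rewrite inE ?hm ?orbT // => /predU1P[->|/mmax].
rewrite -mltNge => /mlt_le h; exists x => [|t]; rewrite inE ?eqxx // => /predU1P[->|/mmax k].
  exact: deglex_refl.
exact: deglex_trans k h.
Qed.

End DegLexTheory.

Section LeadingMonomial.
Context {R : realType} {g l : nat}.
Variable le : rel (mono g l).
Hypothesis hle : is_deglex le.
Local Notation row := 'rV[ncpoly R g]_l.
Implicit Types (p q : row) (m : mono g l).

Lemma lm_some p m : lm le p = Some m <->
  m \in supp p /\ forall t, t \in supp p -> le t m.
Proof.
rewrite /lm; set s := sort _ _.
have srt : sorted (fun m1 m2 => le m2 m1) s.
  by apply: sort_sorted => x y; apply: deglex_total.
have tr : transitive (fun m1 m2 => le m2 m1).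
  by move=> y x z h1 h2; apply: (deglex_trans hle) h2 h1.
have mem t : (t \in s) = (t \in supp p) by rewrite mem_sort.
case: s srt mem => [|x s] srt mem /=.
  by split=> // -[]; rewrite -mem.
have xmax t : t \in supp p -> le t x.
  rewrite -mem inE => /predU1P[->|]; first exact: deglex_refl.
  by move=> ts; have /allP/(_ t ts) := order_path_min tr srt.
split=> [[<-]|[hm mmax]]; first by split=> //; rewrite -mem mem_head.
by congr Some; apply: (deglex_anti hle); rewrite xmax // mmax // -mem mem_head.
Qed.

Lemma lm_exists p : p <> 0 -> exists m, lm le p = Some m.
Proof.
move=> /eqP; rewrite -supp_eq0 => /(deglex_max hle)[m hm mmax].
by exists m; apply/lm_some.
Qed.

Lemma lm_mem p m : lm le p = Some m -> m \in supp p.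
Proof. by case/lm_some. Qed.

Lemma lm_max p m t : lm le p = Some m -> t \in supp p -> le t m.
Proof. by case/lm_some => _; apply. Qed.

Lemma lm_neq0 p m : lm le p = Some m -> p != 0.
Proof. by move=> /lm_mem; apply: contraTneq => ->; rewrite supp0. Qed.

Lemma lcE p m : lm le p = Some m -> lc le p = coef m p.
Proof. by rewrite /lc => ->. Qed.

Lemma lc_neq0 p : p != 0 -> lc le p != 0.
Proof.
move=> /eqP /lm_exists [m hm]; rewrite (lcE hm) -mem_supp; exact: lm_mem hm.
Qed.

Lemma lc1_lm p : lc le p = 1 -> exists m, lm le p = Some m.
Proof.
rewrite /lc; case: (lm le p) => [m _|/eqP]; first by exists m.
by rewrite eq_sym oner_eq0.
Qed.

End LeadingMonomial.

(** * Left modules and reduced bases *)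

Lemma sum_scale_if (A : pzRingType) (V : lmodType A) n (F : 'I_n -> V) i c :
  \sum_j (if j == i then c else 0) *: F j = c *: F i.
Proof.
by rewrite (bigD1 i) //= eqxx big1 ?addr0 // => j /negbTE ->; rewrite scale0r.
Qed.

Section LeftModuleTheory.
Context {R : realType} {g l : nat}.
Local Notation row := 'rV[ncpoly R g]_l.
Implicit Types (I J X : set row) (p q : row).

Lemma left_moduleD J p q : left_module J -> J p -> J q -> J (p + q).
Proof. by move=> [_ h] hp hq; have := h 1 p q hp hq; rewrite scale1r. Qed.

Lemma left_moduleZ J a p : left_module J -> J p -> J (a *: p).
Proof. by move=> [h0 h] hp; have := h a p 0 hp h0; rewrite addr0. Qed.

Lemma left_moduleN J p : left_module J -> J p -> J (- p).
Proof. by move=> hJ hp; rewrite -scaleN1r; apply: left_moduleZ. Qed.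

Lemma left_moduleB J p q : left_module J -> J p -> J q -> J (p - q).
Proof. by move=> hJ hp hq; apply: left_moduleD => //; apply: left_moduleN. Qed.

Lemma left_module_sum J (I : Type) (r : seq I) (P : pred I) (F : I -> row) :
  left_module J -> (forall i, P i -> J (F i)) -> J (\sum_(i <- r | P i) F i).
Proof.
by move=> hJ h; apply: big_ind => //; [case: hJ|move=> p q; apply: left_moduleD].
Qed.

Lemma module_gen_module X : left_module (module_gen X).
Proof.
split=> [J [[]]//|a p q hp hq J hJ].
by case: (hJ) => -[_ h] _; apply: h; [apply: hp|apply: hq].
Qed.

Lemma sub_module_gen X : X `<=` module_gen X.
Proof. by move=> p hp J [_]; apply. Qed.

Lemma module_gen_sub X J : left_module J -> X `<=` J -> module_gen X `<=` J.
Proof. by move=> hJ XJ p; apply. Qed.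

Lemma module_gen_sub_gen X Y : X `<=` module_gen Y -> module_gen X `<=` module_gen Y.
Proof. by apply: module_gen_sub; apply: module_gen_module. Qed.

Lemma module_genP (G : seq row) p : module_gen [set` G] p <->
  exists a : 'I_(size G) -> ncpoly R g, p = \sum_i a i *: G`_i.
Proof.
split=> [|[a ->]]; last first.
  apply: left_module_sum => [|i _]; first exact: module_gen_module.
  apply: (left_moduleZ _ (module_gen_module _)).
  by apply: sub_module_gen; rewrite /= mem_nth.
apply: (@module_gen_sub [set` G]
  [set q | exists a : 'I_(size G) -> ncpoly R g, q = \sum_i a i *: G`_i]).
  split=> [|c q1 q2 [a1 ->] [a2 ->]] /=.
    by exists (fun=> 0); rewrite big1 // => i _; rewrite scale0r.
  exists (fun i => c * a1 i + a2 i); rewrite scaler_sumr -big_split /=.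
  by apply: eq_bigr => i _; rewrite scalerDl scalerA.
move=> q /= qG; have lt : (index q G < size G)%N by rewrite index_mem.
exists (fun i => (i == Ordinal lt)%:R); rewrite (bigD1 (Ordinal lt)) //= eqxx scale1r.
by rewrite nth_index // big1 ?addr0 // => i /negbTE ->; rewrite scale0r.
Qed.

End LeftModuleTheory.

Section Reduced.
Context {R : realType} {g l : nat}.
Local Notation row := 'rV[ncpoly R g]_l.
Variable le : rel (mono g l).
Hypothesis hle : is_deglex le.
Variables (n : nat) (th : 'I_n -> row) (L : 'I_n -> mono g l).
Hypothesis L_lm : forall i, lm le (th i) = Some (L i).
Hypothesis L_lc : forall i, coef (L i) (th i) = 1.
Hypothesis L_red : forall i j t, i != j -> t \in supp (th j) -> ~ rdivides (L i) t.
Implicit Types (p q : row) (m t : mono g l).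

Definition nonlead m := forall i, ~ rdivides (L i) m.

Definition chip m := exists i t s, [/\ t \in supp (th i), s <> one & t = mono_mul s m].

Lemma L_supp i : L i \in supp (th i).
Proof. exact: (lm_mem hle (L_lm i)). Qed.

Lemma L_max i t : t \in supp (th i) -> le t (L i).
Proof. exact: (lm_max hle (L_lm i)). Qed.

Lemma rdivides_L_supp i j t : t \in supp (th j) -> rdivides (L i) t -> i = j /\ t = L i.
Proof.
move=> ht hd; case: (eqVneq i j) => [e|ne]; last by case: (L_red ne ht).
split=> //; apply/esym/rdivides_eq => //.
by apply: (deglex_size hle); rewrite e; apply: L_max.
Qed.

(** Two leads dividing the same monomial are nested, and reducedness forbids this for distinct
    indices. *)
Lemma L_inj i j m : rdivides (L i) m -> rdivides (L j) m -> i = j.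
Proof.
move=> [u ->] [v] /mono_mul_comparable[] h.
  by have [] := rdivides_L_supp (L_supp j) h.
by have [] := rdivides_L_supp (L_supp i) h.
Qed.

(** A lead dividing a chip divides the term above the chip, hence is that term; but the chip is
    strictly shorter. *)
Lemma chip_nonlead m : chip m -> nonlead m.
Proof.
move=> [i [t [s [ht s1 e]]]] j hj.
have [_ e2] := rdivides_L_supp ht (rdivides_trans hj (ex_intro _ s e)).
have := rdivides_size hj; rewrite -e2 e size_mono_mul leqNgt.
by rewrite -[X in (X < _)%N]add0n ltn_add2r lt0n size_word_eq0; move/eqP: s1 => ->.
Qed.

Lemma chip_rdivides m t : rdivides m t -> chip t -> chip m.
Proof.
move=> [u ->] [i [t' [s [ht s1 e]]]]; exists i, t', (mmul s u).
split=> //; last by rewrite -mono_mulA.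
by move=> h; apply: s1; have [] := unitm _ _ h.
Qed.

(** The largest of the products [w (L i)], for [w] in the support of [a i], comes from a single pair
    [(i, w)], because distinct leads have no common multiple. Its coefficient in the sum is
    therefore that of [w] in [a i], and nothing cancels it. *)
Lemma lm_lcomb (a : 'I_n -> ncpoly R g) : \sum_i a i *: th i <> 0 ->
  exists i w, lm le (\sum_i a i *: th i) = Some (mono_mul w (L i)).
Proof.
move=> nz; set p := \sum_i _ in nz *.
pose s := [seq mono_mul w (L i) | i <- enum 'I_n, w <- msupp (a i)].
have mem_s i w : w \in msupp (a i) -> mono_mul w (L i) \in s.
  by move=> hw; apply/allpairsPdep; exists i, w; rewrite mem_enum.
have s0 : s != [::].
  apply/eqP => s0; apply: nz; rewrite /p big1 // => i _.
  rewrite (_ : a i = 0) ?scale0r //; apply/eqP; rewrite -msupp_eq0.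
  apply/eqP/fsetP => w; rewrite inE; apply/negP => /mem_s.
  by rewrite s0.
have [m hm mmax] := deglex_max hle s0.
have [i [w [_ hw em]]] := allpairsPdep hm.
exists i, w; apply/lm_some => //.
have sp t : t \in supp p -> le t (mono_mul w (L i)).
  case/supp_sum => j _ /suppZ[u [t' [hu ht' ->]]].
  apply: (deglex_trans hle) (deglex_mul hle u (L_max ht')) _.
  by rewrite -em; apply: mmax; apply: mem_s.
split=> //; rewrite mem_supp.
suff -> : coef (mono_mul w (L i)) p = (a i)@_w by rewrite mcoeff_neq0.
rewrite raddf_sum (bigD1 i) //= big1 ?addr0 => [|j ji].
  rewrite /coef mxE mcoeffM1 ?[X in _ * X]L_lc ?mulr1 // => u v hu hv e.
  pose t : mono g l := (v, (L i).2).
  have ht : t \in supp (th i) by rewrite mem_supp /coef mcoeff_neq0.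
  have e1 : mono_mul u t = mono_mul w (L i) by rewrite /mono_mul e.
  (* [u t] is the maximum of [s], [u (L i)] belongs to [s], and [t] is at most [L i]: all
     inequalities are equalities and [t = L i]. *)
  have h1 : le (mono_mul u (L i)) (mono_mul u t).
    by rewrite e1 -em; apply: mmax; apply: mem_s.
  have h2 : mono_mul u (L i) = mono_mul u t.
    by apply: (deglex_anti hle); rewrite h1 (deglex_mul hle) ?L_max.
  have ev : (L i).1 = v := congr1 fst (mono_mulI h2).
  by move: e; rewrite -ev => /mmulIr.
apply/eqP; rewrite -[_ == 0]negbK -mem_supp; apply/negP => /suppZ[u [t [hu ht e]]].
have h1 : le (mono_mul u (L j)) (mono_mul u t).
  by rewrite -e -em; apply: mmax; apply: mem_s.
have h2 : mono_mul u (L j) = mono_mul u t.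
  by apply: (deglex_anti hle); rewrite h1 (deglex_mul hle) ?L_max.
case/eqP: ji; apply: (@L_inj _ _ (mono_mul w (L i))); first by exists u; rewrite e.
by exists w.
Qed.

(** Having such a decomposition is stable under linear combinations, so monomials suffice. For
    [m = w (L i)], subtracting [w (th i)] leaves only smaller monomials. *)
Lemma normal_form p : exists (r : row) (a : 'I_n -> ncpoly R g),
  p = r + \sum_i a i *: th i /\ forall m, m \in supp r -> nonlead m.
Proof.
pose NF q := exists (r : row) (a : 'I_n -> ncpoly R g),
  q = r + \sum_i a i *: th i /\ forall m, m \in supp r -> nonlead m.
have NF0 : NF 0.
  exists 0, (fun=> 0); rewrite supp0; split=> //.
  by rewrite big1 ?addr0 // => i _; rewrite scale0r.
have NFD q1 q2 : NF q1 -> NF q2 -> NF (q1 + q2).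
  move=> [r1 [a1 [-> h1]]] [r2 [a2 [-> h2]]].
  exists (r1 + r2), (fun i => a1 i + a2 i); split.
    by rewrite addrACA -big_split; congr (_ + _); apply: eq_bigr => i _; rewrite scalerDl.
  by move=> m /suppD[/h1|/h2].
have NFZ c q : NF q -> NF (c%:MP *: q).
  move=> [r [a [-> h]]]; exists (c%:MP *: r), (fun i => c%:MP * a i); split.
    rewrite scalerDr scaler_sumr; apply: (congr1 (+%R _)).
    by apply: eq_bigr => i _; apply: scalerA.
  by move=> m /suppZC /h.
suff NFm m : NF (mono_vec m).
  rewrite (mono_vec_sum p); apply: (big_ind NF) => // m _; exact: NFZ.
elim/(deglex_ind hle): m => m ih.
case: (pselect (nonlead m)) => [hm|].
  exists (mono_vec m), (fun=> 0); split; first by rewrite big1 ?addr0 // => i _; rewrite scale0r.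
  by move=> m'; rewrite supp_mono => /eqP ->.
move=> /existsNP[i /contrapT [w em]].
have [q qE] : exists q, q = << 1%R *g w >> *: th i by eexists.
apply: (eq_ind _ NF _ _ (subrK q (mono_vec m))); apply: (NFD); last first.
  exists 0, (fun j => if j == i then << 1%R *g w >> else 0).
  split=> [|t]; last by rewrite supp0.
  by rewrite qE sum_scale_if add0r.
rewrite (mono_vec_sum (_ - q)) big_seq; apply: (big_ind NF) => // t ht; apply: NFZ.
apply: ih; rewrite /mlt; apply/andP; split; last first.
  apply/eqP => et; move: ht; rewrite et mem_supp rcoefB coef_mono eqxx.
  by rewrite qE em rcoefZU L_lc mulr1 subrr eqxx.
case/suppB: ht; first by rewrite supp_mono => /eqP ->; apply: deglex_refl.
by rewrite qE => /suppZU[t' ht' ->]; rewrite em (deglex_mul hle) // L_max.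
Qed.

End Reduced.

(** * Real left modules *)

Lemma sum_single (V : nmodType) n (A B : 'I_n -> V) i :
  (forall j, j != i -> A j = 0) -> (forall j, B j = 0) -> \sum_j (A j + B j) = A i.
Proof.
move=> hA hB; rewrite (bigD1 i) //= hB addr0 big1 ?addr0 // => j ji.
by rewrite hA // hB addr0.
Qed.

Section RealCore.
Context {R : realType} {g l : nat}.
Local Notation row := 'rV[ncpoly R g]_l.
Variable le : rel (mono g l).
Hypothesis hle : is_deglex le.
Variables (n : nat) (th : 'I_n -> row) (L : 'I_n -> mono g l).
Hypothesis L_lm : forall i, lm le (th i) = Some (L i).
Hypothesis L_lc : forall i, coef (L i) (th i) = 1.
Hypothesis L_red : forall i j t, i != j -> t \in supp (th j) -> ~ rdivides (L i) t.
Implicit Types (p q : row) (m t a b : mono g l).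

Let rdivides_L_supp := rdivides_L_supp hle L_lm L_red.
Let nonlead := nonlead L.
Let chip := chip th.

Lemma scoef_sym_sum (f h : 'I_n -> row) a b :
  scoef a b (\sum_i (adj (f i) *m th i + adj (th i) *m h i)) =
  \sum_i (scoef a b (adj (f i) *m th i) + scoef a b (adj (th i) *m h i)).
Proof. by rewrite raddf_sum; apply: eq_bigr => i _; rewrite raddfD. Qed.

(* In a product [adj (th i) *m h i], the word [(L i)^* m] for [m] a longest
   monomial of all the [h i] is not cancelled by any other product. *)
Lemma lead_part_eq0 (rs : seq row) (G h : 'I_n -> row) :
  (forall p m, p \in rs -> m \in supp p -> nonlead m) ->
  (forall i m, m \in supp (G i) -> nonlead m) ->
  (forall i, exists a : 'I_n -> ncpoly R g, h i = \sum_j a j *: th j) ->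
  \sum_(p <- rs) adj p *m p =
    \sum_i (adj (G i) *m th i + adj (th i) *m G i) + \sum_i adj (th i) *m h i ->
  forall i, h i = 0.
Proof.
move=> rsN GN hI E.
pose s := [seq m | i <- enum 'I_n, m <- supp (h i)].
have mem_s i m : m \in supp (h i) -> m \in s.
  by move=> hm; apply/allpairsPdep; exists i, m; rewrite mem_enum.
have [s0 i|] := eqVneq s [::].
  apply/eqP; rewrite -supp_eq0; case e : supp => [//|m t].
  by have := mem_s i m; rewrite e mem_head s0 => /(_ isT).
case/(deglex_max hle) => m0 /allpairsPdep[i0 [m [_ hm0 em]]] mmax; subst m.
have lm0 : lm le (h i0) = Some m0.
  by apply/lm_some => //; split=> // t ht; apply: mmax; apply: mem_s ht.
(* [h i0] lies in the module, so its leading monomial is a multiple of a lead. Hence no row in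
   normal form contains a multiple of [m0]. *)
have [j0 [w ew]] : exists j w, m0 = mono_mul w (L j).
  have [a ea] := hI i0; have := lm0; rewrite ea => lm0'.
  have [|j [w]] := @lm_lcomb _ _ _ _ hle _ _ _ L_lm L_lc L_red a.
    by move=> z; have := lm_neq0 hle lm0'; rewrite z eqxx.
  by rewrite lm0' => -[->]; exists j, w.
have divm0 m : rdivides m0 m -> rdivides (L j0) m.
  by apply: rdivides_trans; exists w.
have szm0 : (size (L j0).1 <= size m0.1)%N by rewrite ew size_mono_mul leq_addl.
have div_t i t : t \in supp (th i) -> rdivides (L i0) t -> i = i0 /\ t = L i0.
  by move=> ht /(rdivides_L_supp ht)[->].
(* Any other way to write the word [(L i0)^* m0] moves the cut: to the right, [a] becomes a multiple
   of [L i0]; to the left, [b] becomes a proper multiple of [m0]. *)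
have lev a b : a.2 = (L i0).2 -> b.2 = m0.2 -> sprod a b = sprod (L i0) m0 ->
   rdivides (L i0) a \/ (size a.1 < size (L i0).1)%N /\ exists2 s, s <> one & b = mono_mul s m0.
  move=> e1 e2 e; case: (leqP (size (L i0).1) (size a.1)) => sz.
    by left; have [u [-> _]] := sprod_levi (esym e) (esym e1) (esym e2) sz; exists (word_star u).
  right; split=> //; have [u [e3 ->]] := sprod_levi e e1 e2 (ltnW sz).
  by exists u => // u1; move: sz; rewrite e3 u1 word_star1 mono_mul1 ltnn.
have Er : scoef (L i0) m0 (\sum_(p <- rs) adj p *m p) = 0.
  rewrite raddf_sum big_seq big1 //= => p hp.
  apply: scoef_adjmul0 => a b ha hb e1 e2 /(lev _ _ e1 e2)[d|[_ [u _ eb]]].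
    exact: (rsN p a hp ha i0).
  by apply: (rsN p b hp hb j0); apply: divm0; exists u.
have szu u m : u <> one -> (size m.1 < size (mono_mul u m).1)%N.
  by move/eqP=> u1; rewrite size_mono_mul -[X in (X < _)%N]add0n ltn_add2r lt0n size_word_eq0.
(* Factors from [G i] contain no multiple of a lead. A factor from [th i] that is a multiple of a
   lead equals that lead: as [b] it would be too short, and as [a] it forces [b = m0], which [G i]
   excludes. *)
have EG : scoef (L i0) m0 (\sum_i (adj (G i) *m th i + adj (th i) *m G i)) = 0.
  rewrite scoef_sym_sum big1 // => i _.
  apply: etrans (congr2 +%R (scoef_adjmul0 _) (scoef_adjmul0 _)) (addr0 _) => a b ha hb e1 e2 e;
    have [d|[lt [u u1 eb]]] := lev _ _ e1 e2 e.
  - exact: (GN i a ha i0).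
  - have [|_ e3] := rdivides_L_supp hb (_ : rdivides (L j0) b); first by apply: divm0; exists u.
    by have := szu u m0 u1; rewrite -eb e3 ltnNge szm0.
  - have [_ ea] := div_t _ _ ha d.
    have eb : b = m0.
      case: (b) (m0) e e2 => [b1 b2] [c1 c2] /=; rewrite ea /sprod /= => /mmulI -> -> //.
    by apply: (GN i b hb j0); rewrite eb; apply: divm0; apply: rdivides_refl.
  - by apply: (GN i b hb j0); apply: divm0; exists u.
(* The one surviving contribution is that of [L i0] and [m0] in the product of index [i0], with the
   nonzero value [coef m0 (h i0)]. *)
have := congr1 (scoef (L i0) m0) E.
rewrite Er raddfD /= EG add0r raddf_sum (bigD1 i0) //= big1 ?addr0 => [|i ii0].
  rewrite scoef_adjmul1 => [|a b ha hb e1 e2 e]; last first.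
    have [d|[_ [u u1 eb]]] := lev _ _ e1 e2 e; first by have [] := div_t _ _ ha d.
    have := deglex_size hle (mmax b (mem_s _ _ hb)).
    by rewrite eb leqNgt szu.
  rewrite L_lc mul1r => e; have := lm_mem hle lm0.
  by rewrite mem_supp -e eqxx.
apply: scoef_adjmul0 => a b ha hb e1 e2 e.
have [d|[_ [u u1 eb]]] := lev _ _ e1 e2 e.
  by have [ei _] := div_t _ _ ha d; rewrite ei eqxx in ii0.
have := deglex_size hle (mmax b (mem_s _ _ hb)).
by rewrite eb leqNgt szu.
Qed.

Let lev a b a' b' : sprod a b = sprod a' b' -> a.2 = a'.2 -> b.2 = b'.2 ->
  [\/ a = a' /\ b = b',
      (exists2 s, s <> one & a = mono_mul s a') /\ rdivides b b' |
      rdivides a a' /\ (exists2 s, s <> one & b = mono_mul s b')].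
Proof.
move=> e e1 e2; case: (leqP (size a.1) (size a'.1)) => sz.
  have [s [e3 e4]] := sprod_levi e e1 e2 sz.
  case: (eqVneq s one) => [s1|/eqP s1].
    by apply: Or31; rewrite e3 e4 s1 word_star1 !mono_mul1.
  by apply: Or33; split; [exists (word_star s)|exists s].
have [s [e3 e4]] := sprod_levi (esym e) (esym e1) (esym e2) (ltnW sz).
apply: Or32; split; last by exists s.
exists (word_star s) => // /(congr1 (@word_star g)); rewrite word_starK word_star1 => s1.
by move: sz; rewrite e3 s1 word_star1 mono_mul1 ltnn.
Qed.

(* The words [m^* (L i)] and [m^* m] for a longest monomial [m] which is not a
   chip arise only from the coefficients of [m] in [G i] and in the squares. *)
Lemma sos_supp_chip (rs : seq row) (G : 'I_n -> row) :
  (forall p m, p \in rs -> m \in supp p -> nonlead m) ->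
  (forall i m, m \in supp (G i) -> nonlead m) ->
  \sum_(p <- rs) adj p *m p = \sum_i (adj (G i) *m th i + adj (th i) *m G i) ->
  (forall p m, p \in rs -> m \in supp p -> chip m) /\
  (forall i m, m \in supp (G i) -> chip m).
Proof.
move=> rsN GN E.
pose s := [seq m <- [seq m | p <- rs, m <- supp p] ++
                    [seq m | i <- enum 'I_n, m <- supp (G i)] | ~~ `[< chip m >]].
have srs p m : p \in rs -> m \in supp p -> ~ chip m -> m \in s.
  move=> hp hm /asboolPn hc; rewrite mem_filter hc mem_cat; apply/orP; left.
  by apply/allpairsPdep; exists p, m.
have sG i m : m \in supp (G i) -> ~ chip m -> m \in s.
  move=> hm /asboolPn hc; rewrite mem_filter hc mem_cat; apply/orP; right.
  by apply/allpairsPdep; exists i, m; rewrite mem_enum.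
have [s0|] := eqVneq s [::].
  split=> [p m hp hm|i m hm]; apply: contrapT => hc.
    by have := srs _ _ hp hm hc; rewrite s0.
  by have := sG _ _ hm hc; rewrite s0.
case/(deglex_max hle) => m ms mmax; exfalso.
have mc : ~ chip m by move: ms; rewrite mem_filter => /andP[/asboolPn].
have szm t u : u <> one -> t \in s -> t = mono_mul u m -> False.
  move=> /eqP u1 /mmax /(deglex_size hle) sz e; move: sz; rewrite e size_mono_mul.
  by rewrite leqNgt -[X in (X < _)%N]add0n ltn_add2r lt0n size_word_eq0 u1.
(* A proper left multiple of [m] in a square or in some [G i] is impossible: as a chip it would make
   [m] a chip, otherwise it would be a longer element of [s]. In [th i] it would make [m] a chip by
   definition. *)
have rs_big p t u : p \in rs -> t \in supp p -> u <> one -> t = mono_mul u m -> False.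
  move=> hp ht u1 e; apply: (szm t u) => //; apply: srs hp ht _ => tc.
  by apply: mc; apply: chip_rdivides tc; exists u.
have G_big i t u : t \in supp (G i) -> u <> one -> t = mono_mul u m -> False.
  move=> ht u1 e; apply: (szm t u) => //; apply: sG ht _ => tc.
  by apply: mc; apply: chip_rdivides tc; exists u.
have th_big i t u : t \in supp (th i) -> u <> one -> t = mono_mul u m -> False.
  by move=> ht u1 e; apply: mc; exists i, t, u.
(* At the word [m^* (L i)] only the product of [G i] with [th i] contributes, and only through the
   pair [m], [L i]. The squares contribute nothing, so [m] is absent from [G i]. *)
have thG i j : scoef m (L i) (adj (th j) *m G j) = 0.
  apply: scoef_adjmul0 => a b ha hb e1 e2 e.
  have [[_ eb]|[[u u1 ea] _]|[_ [u u1 eb]]] := lev e e1 e2.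
  - by apply: (GN j b hb i); rewrite eb; apply: rdivides_refl.
  - exact: (th_big j a u).
  - by apply: (GN j b hb i); exists u.
have Gthj i j : j != i -> scoef m (L i) (adj (G j) *m th j) = 0.
  move=> ji; apply: scoef_adjmul0 => a b ha hb e1 e2 e; case/negP: ji; rewrite eq_sym.
  have [[_ eb]|[[u u1 ea] _]|[_ [u u1 eb]]] := lev e e1 e2.
  - have [->] : i = j /\ b = L i; last by [].
    by apply: rdivides_L_supp hb _; rewrite eb; apply: rdivides_refl.
  - by case: (G_big j a u).
  - by have [->] : i = j /\ b = L i by apply: rdivides_L_supp hb _; exists u.
have Gthi i : scoef m (L i) (adj (G i) *m th i) = coef m (G i) * coef (L i) (th i).
  apply: scoef_adjmul1 => a b ha hb e1 e2 e.
  have [[]//|[[u u1 ea] _]|[_ [u u1 eb]]] := lev e e1 e2; first by case: (G_big i a u).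
  have [_ e3] : i = i /\ b = L i by apply: rdivides_L_supp hb _; exists u.
  have := congr1 (fun m => size m.1) eb; rewrite e3 size_mono_mul -[X in X = _]add0n.
  by move=> /eqP; rewrite eqn_add2r eq_sym size_word_eq0 => /eqP.
have Gm i : coef m (G i) = 0.
  have := congr1 (scoef m (L i)) E; rewrite scoef_sym_sum raddf_sum big_seq big1 => [|p hp].
    by rewrite (sum_single (Gthj i) (thG i)) Gthi L_lc mulr1.
  apply: scoef_adjmul0 => a b ha hb e1 e2 e.
  have [[_ eb]|[[u u1 ea] _]|[_ [u _ eb]]] := lev e e1 e2.
  - by apply: (rsN p b hp hb i); rewrite eb; apply: rdivides_refl.
  - exact: (rs_big p a u).
  - by apply: (rsN p b hp hb i); exists u.
(* With [m] gone from every [G i], no mixed product reaches the word [m^* m]: the squares of the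
   coefficients of [m] in [rs] add up to zero. *)
have Gth i : scoef m m (adj (G i) *m th i) = 0.
  apply: scoef_adjmul0 => a b ha hb e1 e2 e.
  have [[ea _]|[[u u1 ea] _]|[_ [u u1 eb]]] := lev e e1 e2.
  - by move: ha; rewrite ea mem_supp Gm eqxx.
  - exact: (G_big i a u).
  - exact: (th_big i b u).
have thG' i : scoef m m (adj (th i) *m G i) = 0.
  by rewrite -(adjK (G i)) -adjM scoef_adj; apply: Gth.
have := congr1 (scoef m m) E; rewrite scoef_sym_sum [RHS]big1 => [|i _]; last first.
  exact: etrans (congr2 +%R (Gth i) (thG' i)) (addr0 _).
rewrite raddf_sum big_seq.
have sq p : p \in rs -> scoef m m (adj p *m p) = coef m p ^+ 2.
  move=> hp; rewrite expr2; apply: scoef_adjmul1 => a b ha hb e1 e2 e.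
  have [[]//|[[u u1 ea] _]|[_ [u u1 eb]]] := lev e e1 e2; first by case: (rs_big p a u).
  by case: (rs_big p b u).
under eq_bigr => p hp do rewrite /= (sq p hp).
rewrite -big_seq => /eqP; rewrite psumr_eq0 => [/allP h0|p _]; last exact: sqr_ge0.
move: ms; rewrite mem_filter mem_cat => /andP[_ /orP[]] /allpairsPdep.
  move=> [p [t [hp ht et]]]; subst t; move: ht; rewrite mem_supp.
  by have := h0 p hp; rewrite /= sqrf_eq0 => ->.
by move=> [i [t [_ ht et]]]; subst t; move: ht; rewrite mem_supp Gm eqxx.
Qed.

End RealCore.

Lemma mulmx_add_opp (A : pzRingType) m k n (P T' : 'M[A]_(m, k)) (T H : 'M[A]_(k, n)) :
  - (P *m T + T' *m H) = - P *m T + T' *m - H.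
Proof. by rewrite opprD mulNmx mulmxN. Qed.

Lemma mulmx_add_crossed (A : pzRingType) m k n (P P' T' : 'M[A]_(m, k))
    (T F H : 'M[A]_(k, n)) :
  P *m T + T' *m H + (T' *m F + P' *m T) = (P + P') *m T + T' *m (F + H).
Proof.
by rewrite mulmxDl mulmxDr [T' *m F + P' *m T]addrC addrACA [T' *m H + _]addrC.
Qed.

Lemma mulmx_split (A : pzRingType) m k n (P E T' : 'M[A]_(m, k)) (T F D : 'M[A]_(k, n)) :
  (P + E) *m T + T' *m (F + D) = P *m T + T' *m F + (T' *m D + E *m T).
Proof.
by rewrite mulmxDl mulmxDr [T' *m D + _]addrC addrACA.
Qed.

Lemma mulmx_split_sum (A : pzRingType) n l (T : 'I_n -> 'rV[A]_l) (T' : 'I_n -> 'cV[A]_l)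
    (G : 'I_n -> 'rV[A]_l) (G' : 'I_n -> 'cV[A]_l) (a s : 'I_n -> 'I_n -> A) :
  \sum_i ((G' i + \sum_j T' j *m (s i j)%:M) *m T i + T' i *m (G i + \sum_j a i j *: T j)) =
  \sum_i (G' i *m T i + T' i *m G i) + \sum_i T' i *m (\sum_j (a i j + s j i) *: T j).
Proof.
under eq_bigr => i _ do rewrite mulmx_split.
rewrite big_split /=; congr (_ + _).
under [RHS]eq_bigr => i _.
  under eq_bigr => j _ do rewrite scalerDl.
  rewrite big_split mulmxDr /=; over.
rewrite !big_split /=; congr (_ + _).
under eq_bigr => i _ do rewrite mulmx_suml.
rewrite exchange_big; apply: eq_bigr => i _; rewrite mulmx_sumr.
by apply: eq_bigr => j _; rewrite -mulmxA mul_scalar_mx.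
Qed.

(** Read [P], [P'], [E] as the adjoints of [p], [r], [p - r]: then [r^* r] and [p^* p] differ by
    products having [p - r] or its adjoint as a factor. *)
Lemma mulmx_sub_square (A : pzRingType) m k n (P P' E : 'M[A]_(m, k)) (p r : 'M[A]_(k, n)) :
  P' + E = P -> P' *m r = P *m p + - (P *m (p - r) + E *m r).
Proof.
by move=> <-; rewrite mulmxBr opprD opprB addrA [X in X - _]addrC subrK mulmxDl addrK.
Qed.

Section RealModule.
Context {R : realType} {g l : nat}.
Local Notation row := 'rV[ncpoly R g]_l.
Local Notation sqr := 'M[ncpoly R g]_l.

Lemma sos_adj (ps : seq row) :
  adj (\sum_(p <- ps) adj p *m p) = \sum_(p <- ps) adj p *m p.
Proof. by rewrite adj_sum; apply: eq_bigr => p _ /=; rewrite adjM adjK. Qed.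

Section Form.
Variables (n : nat) (th : 'I_n -> row).

(** The space [R^(l x 1) J] for the module [J] generated by the [th i]: the coefficients of an
    element of [J] are absorbed into the columns [adj (f i)]. *)
Definition left_form (X : sqr) := exists f : 'I_n -> row, X = \sum_i adj (f i) *m th i.

Definition two_sided_form (X : sqr) :=
  exists f h : 'I_n -> row, X = \sum_i (adj (f i) *m th i + adj (th i) *m h i).

Lemma left_form0 : left_form 0.
Proof. by exists (fun=> 0); rewrite big1 // => i _; rewrite adj0 mul0mx. Qed.

Lemma left_formD X Y : left_form X -> left_form Y -> left_form (X + Y).
Proof.
move=> [f ->] [h ->]; exists (fun i => f i + h i); rewrite -big_split.
by apply: eq_bigr => i _ /=; rewrite adjD mulmxDl.
Qed.

Lemma left_formZ c X : left_form X -> left_form (c%:MP *: X).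
Proof.
move=> [f ->]; exists (fun i => c%:MP *: f i); rewrite scaler_sumr.
by apply: eq_bigr => i _; rewrite adjZC -scalemxAl.
Qed.

Lemma left_formM (A : 'M[ncpoly R g]_(l, 1)) (a : 'I_n -> ncpoly R g) :
  left_form (A *m \sum_i a i *: th i).
Proof.
exists (fun i => adj (A *m (a i)%:M)); rewrite mulmx_sumr.
by apply: eq_bigr => i _; rewrite adjK -mulmxA mul_scalar_mx.
Qed.

Lemma two_sided_formP X : two_sided_form X <->
  exists Y Z, [/\ left_form Y, left_form Z & X = Y + adj Z].
Proof.
split=> [[f [h ->]]|[Y [Z [[f ->] [h ->] ->]]]].
  exists (\sum_i adj (f i) *m th i), (\sum_i adj (h i) *m th i).
  split; [by exists f|by exists h|].
  rewrite adj_sum -big_split; apply: eq_bigr => i _ /=.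
  by rewrite adjM adjK.
exists f, h; rewrite adj_sum -big_split; apply: eq_bigr => i _ /=.
by rewrite adjM adjK.
Qed.

Lemma two_sided_formD X Y : two_sided_form X -> two_sided_form Y -> two_sided_form (X + Y).
Proof.
move=> /two_sided_formP[X1 [X2 [h1 h2 ->]]] /two_sided_formP[Y1 [Y2 [h3 h4 ->]]].
apply/two_sided_formP; exists (X1 + Y1), (X2 + Y2); split; try exact: left_formD.
by rewrite adjD addrACA.
Qed.

Lemma two_sided_form_sum (I : Type) (s : seq I) (F : I -> sqr) :
  (forall i, two_sided_form (F i)) -> two_sided_form (\sum_(i <- s) F i).
Proof.
move=> h; apply: (big_ind two_sided_form) => //; last exact: two_sided_formD.
by apply/two_sided_formP; exists 0, 0; rewrite adj0 addr0; split; try exact: left_form0.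
Qed.

Lemma two_sided_formN X : two_sided_form X -> two_sided_form (- X).
Proof.
move=> [f [h ->]]; exists (fun i => - f i), (fun i => - h i).
rewrite -sumrN; apply: eq_bigr => i _.
by rewrite adjN; apply: mulmx_add_opp.
Qed.

(** Adding the adjoint of a representation of [X] to the representation itself puts the same rows
    [f i + h i] on both sides. This is where the doubling of the sum of squares comes from. *)
Lemma two_sided_form_adj X : two_sided_form X -> adj X = X ->
  exists f : 'I_n -> row, X + X = \sum_i (adj (f i) *m th i + adj (th i) *m f i).
Proof.
move=> [f [h e]] s; exists (fun i => f i + h i); rewrite -{2}s {1 2}e adj_sum -big_split.
apply: eq_bigr => i _; rewrite adjD; apply: etrans (mulmx_add_crossed _ _ _ _ _ _).
by apply: congr2 => //; rewrite adjD; apply: congr2; rewrite adjM ?adjK.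
Qed.

End Form.

Lemma real_span_form (G : seq row) X : real_span (module_gen [set` G]) X ->
  two_sided_form (fun i : 'I_(size G) => G`_i) X.
Proof.
move=> [u [v [[s [hs ->]] [t [ht ->]] ->]]]; apply/two_sided_formP.
exists (\sum_(x <- s) x.1.1%:MP *: (x.1.2 *m x.2)),
       (adj (\sum_(x <- t) x.1.1%:MP *: (x.1.2 *m x.2))).
rewrite adjK; split=> //.
  rewrite big_seq; apply: (big_ind (left_form _)) => [||x xs].
  - exact: left_form0.
  - exact: left_formD.
  - apply: left_formZ; have [_ /module_genP[a ->]] := hs x xs.
    exact: left_formM.
rewrite adj_sum big_seq; apply: (big_ind (left_form _)) => [||x xs].
- exact: left_form0.
- exact: left_formD.
- rewrite adjZC; apply: left_formZ; have [[q /module_genP[a ->] <-] _] := ht x xs.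
  by rewrite adjM adjK; apply: left_formM.
Qed.

(** The module part of [f i] contributes [th_j^* (a i j)^* th_i] on the left side. Exchanging the
    two indices moves it to the right side, whence the coefficient [a i j] plus the star of
    [a j i]. *)
Lemma form_split n (th f G : 'I_n -> row) (a : 'I_n -> 'I_n -> ncpoly R g) :
  (forall i, f i = G i + \sum_j a i j *: th j) ->
  \sum_i (adj (f i) *m th i + adj (th i) *m f i) =
  \sum_i (adj (G i) *m th i + adj (th i) *m G i) +
  \sum_i adj (th i) *m (\sum_j (a i j + poly_star (a j i)) *: th j).
Proof.
move=> ef; apply: etrans (mulmx_split_sum th (fun i => adj (th i)) G (fun i => adj (G i)) a
  (fun i j => poly_star (a i j))).
apply: eq_bigr => i _; apply: congr2; last by rewrite ef.
apply: (congr1 (mulmx^~ (th i))); rewrite ef adjD; apply: (congr1 (+%R _)).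
by rewrite adj_sum; apply: eq_bigr => j _; apply: adjZl.
Qed.

End RealModule.

Section NoSosReal.
Context {R : realType} {g l : nat}.
Local Notation row := 'rV[ncpoly R g]_l.
Variable le : rel (mono g l).
Hypothesis hle : is_deglex le.
Variable G : seq row.
Let n := size G.
Let th (i : 'I_n) := G`_i.
Variable L : 'I_n -> mono g l.
Hypothesis L_lm : forall i, lm le (th i) = Some (L i).
Hypothesis L_lc : forall i, coef (L i) (th i) = 1.
Hypothesis L_red : forall i j t, i != j -> t \in supp (th j) -> ~ rdivides (L i) t.

Lemma no_sos_real :
  (forall (rs : seq row) (f : 'I_n -> row),
    (forall p m, p \in rs -> m \in supp p -> chip th m) ->
    (forall i m, m \in supp (f i) -> chip th m) ->
    \sum_(p <- rs) adj p *m p = \sum_i (adj (f i) *m th i + adj (th i) *m f i) ->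
    forall p, p \in rs -> p = 0) ->
  real_module (module_gen [set` G]).
Proof.
move=> nosos ps hps.
have /choice[nf hnf] : forall p, exists r : row,
    (exists a : 'I_n -> ncpoly R g, p = r + \sum_i a i *: th i) /\
    forall m, m \in supp r -> nonlead L m.
  move=> p; have [r [a [e h]]] := normal_form hle L_lm L_lc p.
  by exists r; split=> //; exists a.
pose rs := map nf ps.
have frs : two_sided_form th (\sum_(p <- rs) adj p *m p).
  have -> : \sum_(p <- rs) adj p *m p = \sum_(p <- ps) adj p *m p +
      - \sum_(p <- ps) (adj p *m (p - nf p) + adj (p - nf p) *m nf p).
    rewrite -sumrN -big_split big_map; apply: eq_bigr => p _ /=.
    by apply: mulmx_sub_square; rewrite -adjD addrC subrK.
  apply: two_sided_formD; first exact: real_span_form hps.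
  apply: two_sided_formN; apply: two_sided_form_sum => p.
  have [[a e] _] := hnf p.
  have -> : p - nf p = \sum_i a i *: th i by rewrite {1}e addrC addKr.
  apply/two_sided_formP; exists (adj p *m \sum_i a i *: th i), (adj (nf p) *m \sum_i a i *: th i).
  by split; rewrite ?adjM ?adjK //; apply: left_formM.
have [f ef] := two_sided_form_adj frs (sos_adj _).
have /choice[a ha] : forall i, exists b : 'I_n -> ncpoly R g,
    f i = nf (f i) + \sum_j b j *: th j.
  by move=> i; have [[b e] _] := hnf (f i); exists b.
(* Repeating the list keeps the doubled sum a sum of squares. *)
have E : \sum_(p <- rs ++ rs) adj p *m p =
  \sum_i (adj (nf (f i)) *m th i + adj (th i) *m nf (f i)) +
  \sum_i adj (th i) *m (\sum_j (a i j + poly_star (a j i)) *: th j).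
  apply: etrans (big_cat _ _ _ _ _) _; apply: etrans ef _.
  exact: (form_split ha).
have rsN p m : p \in rs ++ rs -> m \in supp p -> nonlead L m.
  rewrite mem_cat orbb => /mapP[q _ ->]; exact: (hnf q).2.
have GN i m : m \in supp (nf (f i)) -> nonlead L m by apply: (hnf (f i)).2.
have h0 := lead_part_eq0 hle L_lm L_lc L_red rsN GN (fun i => ex_intro _ _ erefl) E.
have E' : \sum_(p <- rs ++ rs) adj p *m p =
    \sum_i (adj (nf (f i)) *m th i + adj (th i) *m nf (f i)).
  apply: etrans E _; apply: etrans (congr2 +%R erefl (big1 _ _ _ _)) (addr0 _) => i _.
  exact: etrans (congr1 (mulmx _) (h0 i)) (mulmx0 _ _).
have [c1 c2] := sos_supp_chip hle L_lm L_lc L_red rsN GN E'.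
move=> p hp; have [[b e] _] := hnf p.
have r0 : nf p = 0.
  by apply: (nosos _ _ c1 c2 E'); rewrite mem_cat map_f.
by apply/module_genP; exists b; rewrite {1}e r0 add0r.
Qed.

End NoSosReal.

(** * Gram matrices *)

Section Gram.
Context {R : realType} {g l : nat}.
Local Notation row := 'rV[ncpoly R g]_l.
Implicit Types (M : seq (mono g l)).

Lemma mono_vecE (m : mono g l) j : mono_vec m 0 j = << (m.2 == j)%:R *g m.1 >> :> ncpoly R g.
Proof.
rewrite !mxE eqxx eq_sym /=; case: (_ == _); first by rewrite mulr1.
by rewrite mulr0 monalgU0.
Qed.

Lemma cstM m k n (A : 'M[R]_(m, k)) (B : 'M[R]_(k, n)) :
  cst (A *m B) = cst A *m cst B :> 'M[ncpoly R g]_(m, n).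
Proof. exact: (map_mxM (@mkmalgU (word g) R one)). Qed.

Lemma cstD m n (A B : 'M[R]_(m, n)) : cst (A + B) = cst A + cst B :> 'M[ncpoly R g]_(m, n).
Proof. exact: (map_mxD (@mkmalgU (word g) R one)). Qed.

Lemma cstZ m n c (A : 'M[R]_(m, n)) : cst (c *: A) = c%:MP *: cst A :> 'M[ncpoly R g]_(m, n).
Proof. exact: (map_mxZ (@mkmalgU (word g) R one)). Qed.

Lemma cst0 m n : cst (0 : 'M[R]_(m, n)) = 0 :> 'M[ncpoly R g]_(m, n).
Proof. exact: (map_mx0 (@mkmalgU (word g) R one)). Qed.

Definition mono_at M (a : 'I_(size M)) : mono g l := tnth (in_tuple M) a.

(** The monomial of the [l x l] matrices to which entry [(a, b)] of a Gram matrix contributes.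
    Several entries may share one monomial, so Gram matrices are not unique. *)
Definition star_at M (a b : 'I_(size M)) : 'I_l * 'I_l * word g :=
  ((mono_at a).2, (mono_at b).2, sprod (mono_at a) (mono_at b)).

Lemma mem_mono_at M (a : 'I_(size M)) : mono_at a \in M.
Proof. exact: mem_tnth. Qed.

Lemma mono_at_inj M : uniq M -> injective (@mono_at M).
Proof. by move=> uM; apply/tuple_uniqP. Qed.

Lemma mono_atP M m : m \in M -> exists a : 'I_(size M), mono_at a = m.
Proof. by move=> /(tnthP (in_tuple M))[a ->]; exists a. Qed.

Lemma star_productsP M x :
  x \in star_products M <-> exists a b : 'I_(size M), x = star_at a b.
Proof.
split=> [/allpairsP[[m1 m2] [/= h1 h2 ->]]|[a [b ->]]].
  by have [[a <-] [b <-]] := (mono_atP h1, mono_atP h2); exists a, b.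
by apply/allpairsP; exists (mono_at a, mono_at b); rewrite !mem_mono_at.
Qed.

Lemma star_at_sym M (a b c d : 'I_(size M)) :
  (star_at a b == star_at c d) = (star_at b a == star_at d c).
Proof.
apply/eqP/eqP => -[e1 e2 e3]; rewrite /star_at e1 e2.
  by rewrite -(sprod_star (mono_at a)) e3 sprod_star.
by rewrite -(sprod_star (mono_at b)) e3 sprod_star.
Qed.

Lemma columnE M (a : 'I_(size M)) j :
  column M a j = << ((mono_at a).2 == j)%:R *g (mono_at a).1 >> :> ncpoly R g.
Proof. by apply: etrans (mono_vecE _ _); rewrite mxE. Qed.

Lemma adj_columnE M (a : 'I_(size M)) i : adj (column M) i a =
  << ((mono_at a).2 == i)%:R *g word_star (mono_at a).1 >> :> ncpoly R g.
Proof.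
by apply: etrans (adjE _ _ _) _; apply: etrans (congr1 _ (columnE _ _)) (poly_starU _ _).
Qed.

Lemma cstE m n (B : 'M[R]_(m, n)) a b : cst B a b = (B a b)%:MP :> ncpoly R g.
Proof. by rewrite mxE. Qed.

Lemma gram_coef M (B : 'M[R]_(size M)) i j w :
  (gram B i j)@_w = \sum_a \sum_b B a b *+ (star_at a b == (i, j, w)).
Proof.
rewrite /gram mxE raddf_sum exchange_big; apply: eq_bigr => b _ /=.
rewrite mxE mulr_suml raddf_sum; apply: eq_bigr => a _ /=.
apply: etrans (congr1 (mcoeff w) (congr2 *%R (congr2 *%R (adj_columnE a i) (cstE B a b))
  (columnE b j))) _.
apply: etrans (congr1 (mcoeff w) (congr2 *%R (malgUM _ _ _ _) erefl)) _.
apply: etrans (congr1 (mcoeff w) (malgUM _ _ _ _)) _.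
rewrite mulm1 mcoeffU /star_at !xpair_eqE /sprod /mono_at.
case: (_ == i); rewrite /= ?mul0r ?mul0rn //.
by case: (_ == j); rewrite /= ?mulr0 ?mul0rn // mul1r mulr1.
Qed.

Lemma gramD M (A B : 'M[R]_(size M)) : gram (A + B) = gram A + gram B.
Proof. by rewrite /gram cstD mulmxDr mulmxDl. Qed.

Lemma gramZ M c (A : 'M[R]_(size M)) : gram (c *: A) = c%:MP *: gram A.
Proof. by rewrite /gram cstZ scaleCAr -scalemxAl. Qed.

Lemma gram0 M : gram (0 : 'M[R]_(size M)) = 0.
Proof. by rewrite /gram cst0 mulmx0 mul0mx. Qed.

Lemma gram_sum M (I : Type) (r : seq I) (F : I -> 'M[R]_(size M)) :
  gram (\sum_(i <- r) F i) = \sum_(i <- r) gram (F i).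
Proof. by apply: (big_morph _ (@gramD M) (@gram0 M)). Qed.

Lemma gram_supported M (B : 'M[R]_(size M)) : supported M (gram B).
Proof.
move=> i j w h; rewrite gram_coef big1 // => a _; rewrite big1 // => b _.
by case: eqP => // e; case/negP: h; apply/star_productsP; exists a, b.
Qed.

Lemma gram_mul_tr M n (T : 'M[R]_(n, size M)) :
  gram (T^T *m T) =
  \sum_(k < n) adj (matrix.row k (cst T *m column M)) *m matrix.row k (cst T *m column M).
Proof.
rewrite /gram cstM -adj_cst mulmxA -adjM -mulmxA; apply/matrixP => i j.
rewrite mxE summxE; apply: eq_bigr => k _.
by rewrite adjmulE !adjE [in RHS]mxE [X in _ = _ * X]mxE.
Qed.

Lemma cst_column M n (T : 'M[R]_(n, size M)) k :
  matrix.row k (cst T *m column M) = \sum_a (T k a)%:MP *: mono_vec (mono_at a).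
Proof.
rewrite row_mul mulmx_sum_row; apply: eq_bigr => a _.
by apply: congr2; [rewrite !mxE|apply: rowK].
Qed.

Lemma supp_cst_column M n (T : 'M[R]_(n, size M)) k m :
  m \in supp (matrix.row k (cst T *m column M)) -> m \in M.
Proof.
rewrite cst_column => /supp_sum[a _ /suppZC]; rewrite supp_mono => /eqP ->.
exact: mem_mono_at.
Qed.

Lemma coef_cst_column M n (T : 'M[R]_(n, size M)) k a : uniq M ->
  coef (mono_at a) (matrix.row k (cst T *m column M)) = T k a.
Proof.
move=> uM; rewrite cst_column; apply: etrans (raddf_sum (coef (mono_at a)) _ _ _) _.
apply: etrans (eq_bigr (fun b => T k b * (b == a)%:R) _) _ => [b _|].
  apply: etrans (rcoefZ _ _ _) _; apply: (congr1 ( *%R _)).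
  by apply: etrans (coef_mono _ _) _; rewrite (inj_eq (mono_at_inj uM)).
by rewrite (bigD1 a) //= eqxx mulr1 big1 ?addr0 // => b /negbTE ->; rewrite mulr0.
Qed.

End Gram.

(** Along [x e_k + e_j] the quadratic form is [2 x Z_kj + Z_jj], affine in [x], hence unbounded
    below unless [Z_kj = 0]. *)
Lemma psd_diag0 (R : realType) n (Z : 'M[R]_n) k : psd Z -> Z k k = 0 -> forall j, Z k j = 0.
Proof.
move=> [sZ pZ] Zkk j; have [->//|kj] := eqVneq j k.
have sjk : Z j k = Z k j by rewrite -[in LHS]sZ mxE.
pose q (x : R) := x *: delta_mx 0 k + delta_mx 0 j : 'rV[R]_n.
have bE a b : (delta_mx 0 a : 'rV_n) *m Z *m (delta_mx 0 b : 'rV_n)^T = (Z a b)%:M.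
  by rewrite trmx_delta -rowE -colE; apply/matrixP => i i'; rewrite !ord1 !mxE eqxx.
have qE x : (q x *m Z *m (q x)^T) 0 0 = x * (Z k j *+ 2) + Z j j.
  rewrite /q linearD linearZ /= !(mulmxDl, mulmxDr) -?(scalemxAl, scalemxAr).
  by rewrite !bE !mxE eqxx !mulr1n Zkk !mulr0 add0r sjk addrA mulr2n mulrDr.
apply: contrapT => /eqP Zkj.
(* At this [x] the form takes the value -1. *)
have := pZ (q (- (Z j j + 1) / (Z k j *+ 2))); rewrite qE.
rewrite mulfVK ?mulrn_eq0 //= opprD addrAC addNr add0r.
by rewrite oppr_ge0 ler10.
Qed.

Lemma psd_mul_tr (R : realType) n m (A : 'M[R]_(n, m)) : psd (A^T *m A).
Proof.
split=> [|v]; first by rewrite trmx_mul trmxK.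
rewrite mulmxA -mulmxA -[v *m A^T]trmxK trmx_mul trmxK mxE.
by apply: sumr_ge0 => i _; rewrite mxE -expr2 sqr_ge0.
Qed.

Lemma mul_tr_eq0 (R : realType) n m (A : 'M[R]_(n, m)) : A^T *m A = 0 -> A = 0.
Proof.
move=> h; apply/matrixP => i j; rewrite mxE; have /matrixP/(_ j j) := h.
rewrite !mxE => /eqP; rewrite psumr_eq0 => [|k _]; last by rewrite mxE -expr2 sqr_ge0.
by move=> /allP/(_ i); rewrite mem_index_enum mxE -expr2 sqrf_eq0 => /(_ isT)/eqP.
Qed.

Section Supported.
Context {R : realType} {g l : nat}.
Implicit Types (M : seq (mono g l)).

Lemma supported_sub M M' (p : 'M[ncpoly R g]_l) :
  {subset M <= M'} -> supported M p -> supported M' p.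
Proof.
move=> MM' h i j w hw; apply: h; apply: contra hw => /allpairsP[[a b] [/= ha hb ->]].
by apply/allpairsP; exists (a, b); rewrite !MM'.
Qed.

Lemma sos_supported M (rs : seq 'rV[ncpoly R g]_l) :
  (forall p m, p \in rs -> m \in supp p -> m \in M) ->
  supported M (\sum_(p <- rs) adj p *m p).
Proof.
move=> rsM i j w hw; rewrite summxE raddf_sum big_seq big1 //= => p hp.
apply: coef_adjmul0 => a b ha hb ea eb ew; case/negP: hw.
apply/allpairsP; exists (a, b); split; [exact: rsM ha|exact: rsM hb|].
by rewrite -ea -eb -ew.
Qed.

(** The rows of [T] are the coefficient vectors of the summands. The last clause carries vanishing
    of the Gram factor back to them. *)
Lemma sos_gram M (rs : seq 'rV[ncpoly R g]_l) :
  (forall p m, p \in rs -> m \in supp p -> m \in M) -> uniq M ->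
  exists2 T : 'M[R]_(size rs, size M),
    gram (T^T *m T) = \sum_(p <- rs) adj p *m p & T = 0 -> forall p, p \in rs -> p = 0.
Proof.
move=> rsM uM; pose T := \matrix_(k < size rs, a < size M) coef (mono_at a) rs`_k.
have TE k : matrix.row k (cst T *m column M) = rs`_k.
  apply: rowP_coef => m; case: (boolP (m \in M)) => [/mono_atP[a <-]|hm].
    by rewrite coef_cst_column // mxE.
  rewrite !coef_notin //; last by apply: contra hm => /supp_cst_column.
  by apply: contra hm; apply: rsM; rewrite mem_nth.
exists T => [|T0 p hp].
  rewrite gram_mul_tr (big_nth 0) big_mkord; apply: eq_bigr => k _.
  by apply: congr2; [apply: congr1|]; apply: TE.
have hi : (index p rs < size rs)%N by rewrite index_mem.
have := TE (Ordinal hi); rewrite /= nth_index // => <-.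
by rewrite T0 cst0 mul0mx row0.
Qed.

End Supported.

(** * The linear pencil and the deletion of its zero diagonal entries *)

Section Pencil.
Context {R : realType} {g l : nat}.
Local Notation row := 'rV[ncpoly R g]_l.

Lemma Ppoly_expand (G : seq row) (alpha : mono g l -> row -> R) :
  Ppoly G alpha = \sum_(m <- chips G) \sum_(t <- G)
    (alpha m t)%:MP *: (adj (mono_vec m) *m t + adj t *m mono_vec m).
Proof.
rewrite /Ppoly exchange_big; apply: eq_bigr => t _; rewrite /Defs.qpoly.
apply/esym; apply: etrans (eq_bigr _ (fun m _ => scalerDr _ _ _)) _.
rewrite big_split; apply: congr2.
  rewrite adj_sum mulmx_suml; apply: eq_bigr => m _.
  have e1 := scalemxAl (alpha m t)%:MP (adj (mono_vec m)) t.
  have e2 := congr1 (mulmx^~ t) (esym (adjZC (alpha m t) (mono_vec m))).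
  have e3 := etrans e1 e2; exact: e3.
rewrite mulmx_sumr; apply: eq_bigr => m _.
exact: esym (scaleCAr (alpha m t) (adj t) (mono_vec m)).
Qed.

Lemma qpoly_coefs (G : seq row) (f : row -> row) (t : row) :
  (forall m, m \in supp (f t) -> m \in chips G) ->
  Defs.qpoly G (fun m t => coef m (f t)) t = f t.
Proof.
move=> hf; apply: rowP_coef => m; rewrite /Defs.qpoly.
apply: etrans (raddf_sum (coef m) _ _ _) _.
apply: etrans (eq_bigr (fun m' => coef m' (f t) * (m' == m)%:R) _) _ => [m' _|].
  by apply: etrans (rcoefZ _ _ _) _; rewrite coef_mono.
case: (boolP (m \in chips G)) => hm.
  rewrite (bigD1_seq m) ?undup_uniq //= eqxx mulr1 big1 ?addr0 // => m' /negbTE ->.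
  by rewrite mulr0.
rewrite coef_notin ?big_seq ?big1 //; last by apply: contra hm; apply: hf.
by move=> m' hm'; case: eqP hm' => [-> h|]; rewrite ?mulr0 //; rewrite h in hm.
Qed.

Section Valid.
Variable D : pencil (R := R) (g := g) (l := l).
Hypothesis hD : valid_pencil D.

Lemma monos_uniq : uniq (monos D).
Proof.
by case: hD => -[[delta /perm_uniq ->] _] _ _; rewrite filter_uniq // undup_uniq.
Qed.

Lemma monos_chips : {subset monos D <= chips (gens D)}.
Proof.
by case: hD => -[[delta /perm_mem h] _] _ _ m; rewrite h mem_filter => /andP[].
Qed.

(** The [Zs] have zero Gram polynomial. Each [Bs] agrees with its polynomial on the products of
    [monos D] only; outside them both sides vanish, the right one by admissibility. *)
Lemma gram_Lmx alpha zeta : supported (chips (gens D)) (Ppoly (gens D) alpha) ->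
  gram (Lmx D alpha zeta) = Ppoly (gens D) alpha.
Proof.
move=> sP; case: hD => -[_ adm] [frZ memZ] hB.
have gZ : gram (\sum_(k < size (Zs D)) zeta k *: (Zs D)`_k) = 0.
  rewrite gram_sum big1 // => k _; rewrite gramZ.
  have /memZ[_ ->] : (Zs D)`_k \in <<Zs D>>%VS by rewrite memv_span // mem_nth.
  by rewrite scaler0.
rewrite /Lmx gramD gZ addr0 gram_sum.
apply/matrixP => i j; apply/malgP => w.
case: (boolP ((i, j, w) \in star_products (monos D))) => hw; last first.
  rewrite (adm _ sP i j w hw); rewrite -gram_sum; exact: gram_supported hw.
rewrite Ppoly_expand !summxE !raddf_sum big_seq [RHS]big_seq; apply: eq_bigr => m hm /=.
rewrite gram_sum !summxE !raddf_sum big_seq [RHS]big_seq; apply: eq_bigr => t ht /=.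
rewrite gramZ; apply: etrans (congr1 (mcoeff w) (mxE _ _ _ _)) _.
apply/esym; apply: etrans (congr1 (mcoeff w) (mxE _ _ _ _)) _.
apply: etrans (mcoeffCM _ _ _) (etrans _ (esym (mcoeffCM _ _ _))).
by apply: (congr1 ( *%R _)); have [_ ->] := hB m t hm ht.
Qed.

Lemma Lmx_sym alpha zeta : (Lmx D alpha zeta)^T = Lmx D alpha zeta.
Proof.
case: hD => _ [_ memZ] hB; rewrite /Lmx linearD /= !linear_sum /=; congr (_ + _).
  rewrite big_seq [RHS]big_seq; apply: eq_bigr => m hm.
  rewrite linear_sum /= big_seq [RHS]big_seq; apply: eq_bigr => t ht.
  by rewrite linearZ /=; have [-> _] := hB m t hm ht.
apply: eq_bigr => k _; rewrite linearZ /=.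
by have /memZ[-> _] : (Zs D)`_k \in <<Zs D>>%VS by rewrite memv_span // mem_nth.
Qed.

(** Two symmetric Gram matrices of the same polynomial differ by an element of the span of [Zs], so
    the pencil reaches all of them from the value at [zeta = 0]. *)
Lemma Lmx_onto alpha (Z : 'M[R]_(size (monos D))) :
  Z^T = Z -> gram Z = Ppoly (gens D) alpha -> exists zeta, Z = Lmx D alpha zeta.
Proof.
move=> sZ gZ; case: (hD) => _ [frZ memZ] _.
have sP : supported (chips (gens D)) (Ppoly (gens D) alpha).
  by rewrite -gZ; apply: supported_sub monos_chips (@gram_supported _ _ _ _ _).
pose L0 := Lmx D alpha (fun=> 0).
have : Z - L0 \in <<Zs D>>%VS.
  apply/memZ; split; first by rewrite linearB /= sZ Lmx_sym.
  by rewrite -scaleN1r gramD gramZ gram_Lmx // gZ rmorphN rmorph1 scaleN1r subrr.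
move=> hZ; have h := coord_span (X := in_tuple (Zs D)) hZ.
(* The coordinates of [Z - L0], extended by 0 past the length of [Zs] since [zeta] is a function on
   [nat]. *)
exists (fun k => if insub k is Some i then coord (in_tuple (Zs D)) i (Z - L0) else 0).
have eZ := subrK L0 Z; rewrite h addrC in eZ.
rewrite -[LHS]eZ /Lmx -[LHS]addrA; congr (_ + _).
rewrite [X in X + _]big1 ?add0r => [|k _]; last by rewrite scale0r.
by apply: eq_bigr => k _; rewrite valK.
Qed.

(** The deletions made so far have lost no positive semidefinite value of the pencil. *)
Definition facial_inv (S : {set 'I_(size (monos D))}) := forall alpha zeta,
  supported (chips (gens D)) (Ppoly (gens D) alpha) ->
  psd (Lmx D alpha zeta) -> feasible S alpha zeta.

Lemma facial_invT : facial_inv [set: 'I_(size (monos D))]%SET.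
Proof. by move=> alpha zeta sP _; split=> // a b; rewrite !inE. Qed.

(** A positive semidefinite value survives the previous deletions, so its diagonal entry at [k]
    vanishes, and with it row and column [k]. *)
Lemma facial_invD1 (S : {set 'I_(size (monos D))}) k :
  facial_inv S -> zero_diag S k -> facial_inv (S :\ k)%SET.
Proof.
move=> inv [kS z] alpha zeta sP pL; have fS := inv alpha zeta sP pL.
split=> // a b; have Lk := psd_diag0 pL (z _ _ fS).
have [->|ak] := eqVneq a k; first by rewrite Lk.
have [->|bk] := eqVneq b k; first by rewrite -Lmx_sym mxE Lk.
by rewrite !inE ak bk /=; apply: fS.2.
Qed.

(* A sum of squares equal to some [P] only involves the chips kept in [monos D],
   because its summands of lowest degree cannot cancel. *)
Lemma no_solution_no_sos (S : {set 'I_(size (monos D))}) :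
  facial_inv S -> (forall alpha zeta, ~ lmi_solution S alpha zeta) ->
  forall (rs : seq row) alpha,
    (forall p m, p \in rs -> m \in supp p -> m \in chips (gens D)) ->
    \sum_(p <- rs) adj p *m p = Ppoly (gens D) alpha ->
    forall p, p \in rs -> p = 0.
Proof.
move=> inv nosol rs alpha rsC eP.
have sP : supported (chips (gens D)) (Ppoly (gens D) alpha).
  by rewrite -eP; apply: sos_supported.
have rsM p m : p \in rs -> m \in supp p -> m \in monos D.
  case: (hD) => -[[delta /perm_mem hM] adm] _ _ hp hm; rewrite hM mem_filter (rsC p) // andbT.
  rewrite leqNgt; apply/negP => lt.
  (* [k] ranges over the degrees of monomials occurring in the summands. The smallest one is
     attained by [m0] and lies below [delta] if some monomial was discarded. *)
  pose Q k := has (fun p => has (fun m : mono g l => size m.1 == k) (supp p)) rs.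
  have exQ : exists k, Q k.
    by exists (size m.1); apply/hasP; exists p => //; apply/hasP; exists m.
  case: (ex_minnP exQ) => k /hasP[p0 hp0 /hasP[m0 hm0 /eqP sz0]] kmin.
  have kd : (k < delta)%N.
    apply: leq_ltn_trans lt; apply: kmin.
    by apply/hasP; exists p => //; apply/hasP; exists m.
  have ge p1 m1 : p1 \in rs -> m1 \in supp p1 -> (size m0.1 <= size m1.1)%N.
    move=> h1 h2; rewrite sz0; apply: kmin.
    by apply/hasP; exists p1 => //; apply/hasP; exists m1.
  (* By minimality neither factor of [m0^* m0] is shorter than [m0], so both have its length and the
     cut is unique. *)
  have sq p1 : p1 \in rs -> scoef m0 m0 (adj p1 *m p1) = coef m0 p1 ^+ 2.
    move=> h1; rewrite expr2; apply: scoef_adjmul1 => a b ha hb e1 e2 e.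
    have := congr1 (fun w : word g => size w) e; rewrite !size_sprod => esz.
    have ea : size a.1 = size m0.1.
      have := ge _ _ h1 ha; have := ge _ _ h1 hb; move: esz.
      move: (size a.1) (size b.1) (size m0.1) => x y z; lia.
    have [u [ea' _]] := sprod_levi (esym e) (esym e1) (esym e2) (eq_leq (esym ea)).
    by rewrite ea'; apply/esym/rdivides_eq; rewrite -?ea' ?ea //; exists (word_star u).
  (* The word [m0^* m0] has length [2 k < 2 delta], too short for a product of two kept chips, so
     admissibility excludes it from [P]. *)
  have : scoef m0 m0 (\sum_(p <- rs) adj p *m p) = 0.
    rewrite eP; apply: (adm _ sP); apply/negP => /allpairsP[[a b] [/= ha hb]].
    move=> [_ _ /(congr1 (fun w : word g => size w))]; rewrite [RHS]size_sprod [LHS]size_sprod.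
    move: ha hb; rewrite !hM !mem_filter => /andP[ha _] /andP[hb _].
    by move: ha hb kd; rewrite sz0; move: (size a.1) (size b.1) => x y; lia.
  rewrite raddf_sum big_seq; under eq_bigr => p1 hp1 do rewrite /= (sq p1 hp1).
  rewrite -big_seq => /eqP; rewrite psumr_eq0 => [/allP/(_ p0 hp0)|p1 _]; last exact: sqr_ge0.
  by rewrite /= sqrf_eq0; move: hm0; rewrite mem_supp => /negbTE ->.
(* [T^T T] is a positive semidefinite value of the pencil that all deletions preserve. Were it
   nonzero, it would solve the linear matrix inequality. *)
have [T gT T0] := sos_gram rsM monos_uniq.
have pT := psd_mul_tr T.
have [zeta eZ] := Lmx_onto pT.1 (etrans gT eP).
apply: T0; apply: mul_tr_eq0; rewrite eZ.
apply: contrapT => /eqP nz; apply: (nosol alpha zeta); split=> //; rewrite -?eZ //.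
by apply: inv => //; rewrite -eZ.
Qed.

End Valid.
End Pencil.

(** * Square roots of positive semidefinite matrices *)

(** Newton's scheme. With [f] the square root and the eigenvalues as nodes, it makes the root of a
    real matrix a real polynomial in that matrix. *)
Lemma poly_interpolation (F : fieldType) (s : seq F) (f : F -> F) : uniq s ->
  exists p : {poly F}, forall x, x \in s -> p.[x] = f x.
Proof.
elim: s => [|a s ih] /= => [_|/andP[as' /ih[p hp]]]; first by exists 0.
pose q := \prod_(y <- s) ('X - y%:P).
have qa : q.[a] != 0 by rewrite -[_ == 0]rootE /q root_prod_XsubC.
exists (p + ((f a - p.[a]) / q.[a])%:P * q) => x.
rewrite inE hornerD hornerCM => /predU1P[->|xs]; first by rewrite divfK // addrC subrK.
have /rootP -> : root q x by rewrite /q root_prod_XsubC.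
by rewrite mulr0 addr0 hp.
Qed.

Lemma mulmx_conj_sqr (F : fieldType) n (P D : 'M[F]_n) : P \in unitmx ->
  (invmx P *m D *m P) *m (invmx P *m D *m P) = invmx P *m (D *m D) *m P.
Proof. by move=> uP; rewrite !mulmxA mulmxK. Qed.

Section PsdSqrt.
Variable R : realType.
Local Notation toC := (@real_complex R).
Local Notation "A ^t*" := (map_mx Num.conj (trmx A)).

Lemma conj_toC (x : R) : Num.conj (toC x) = toC x.
Proof. by apply/CrealP; apply/complex_realP; exists x. Qed.

Lemma map_toC_inj m n : injective (map_mx toC : 'M[R]_(m, n) -> 'M[R[i]%C]_(m, n)).
Proof. exact: map_mx_inj. Qed.

Lemma conj_map_toC m n (A : 'M[R]_(m, n)) : map_mx Num.conj (map_mx toC A) = map_mx toC A.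
Proof. by apply/matrixP => i j; rewrite !mxE conj_toC. Qed.

Lemma toC_le (x y : R) : (toC x <= toC y) = (x <= y).
Proof. exact: lecR. Qed.

(** For [u = x + i y] the cross terms cancel by symmetry of [L], leaving the sum of the real forms
    at [x] and [y]. *)
Lemma psd_complex n (L : 'M[R]_n) (u : 'rV[R[i]%C]_n) : psd L ->
  exists2 x : R, 0 <= x & (u *m map_mx toC L *m u^t*) 0 0 = toC x.
Proof.
move=> [sL pL]; pose x := map_mx (@complex.Re R) u; pose y := map_mx (@complex.Im R) u.
pose X := map_mx toC x; pose Y := map_mx toC y; pose A := map_mx toC L.
have eu : u = X + 'i *: Y.
  by apply/matrixP => a b; rewrite !mxE -complexiE; apply: complexE.
exists ((x *m L *m x^T) 0 0 + (y *m L *m y^T) 0 0); first exact: addr_ge0.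
have eut : u^t* = X^T - 'i *: Y^T.
  apply/matrixP => a b; rewrite !mxE ord1 [in LHS](complexE (u 0 a)).
  by rewrite complexiE rmorphD rmorphM /= conjCi !conj_toC mulNr.
have sA : A^T = A by rewrite /A -[in RHS]sL; apply/matrixP => a b; rewrite !mxE.
have sXY : Y *m A *m X^T = X *m A *m Y^T.
  have -> : Y *m A *m X^T = (Y *m A *m X^T)^T.
    by rewrite [Y *m A *m _]mx11_scalar tr_scalar_mx.
  by rewrite !trmx_mul trmxK sA mulmxA.
rewrite eut eu !(mulmxDl, mulmxBr) -!(scalemxAl, scalemxAr) sXY.
rewrite -/A opprD addrA addrK scalerA -expr2 sqrCi scaleN1r opprK.
have eM (a : 'rV[R]_n) : map_mx toC a *m A *m (map_mx toC a)^T = map_mx toC (a *m L *m a^T).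
  by rewrite map_trmx -!map_mxM.
by rewrite !eM -map_mxD [LHS]mxE; congr toC; rewrite mxE.
Qed.

(** [L] is diagonalised by a unitary matrix over the complex numbers, with real nonnegative
    eigenvalues. Interpolating the square root at them brings the root back to a real matrix. *)
Lemma psd_sqrt n (L : 'M[R]_n) : psd L -> exists2 T, psd T & T *m T = L.
Proof.
case: n L => [|n] L [sL pL].
  by exists 0; [split=> [|v]; rewrite ?trmx0 // !mxE big_ord0|rewrite mul0mx [L]flatmx0].
have [A eL] : exists A, A = map_mx toC L by eexists.
have Aherm : A \is hermsymmx.
  by apply/is_hermitianmxP; rewrite expr0 scale1r -map_trmx eL conj_map_toC map_trmx sL.
have [P [sp [Pu eA]]] : exists P sp, P \is unitarymx /\ A = invmx P *m diag_mx sp *m P.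
  exists (spectralmx A), (spectral_diag A); split; first exact: spectral_unitarymx.
  by apply/orthomx_spectralP/hermitian_normalmx.
have Pi := invmx_unitary Pu; have Pun := unitarymx_unit Pu.
have eD : diag_mx sp = P *m A *m P^t*.
  by rewrite eA -Pi !mulmxA mulmxV // mul1mx mulmxK.
have /choice[d hd] : forall i, exists x : R, 0 <= x /\ sp 0 i = toC x.
  move=> i; have [x x0 ex] := psd_complex (row i P) (conj sL pL).
  exists x; split=> //; rewrite -ex -eL -row_mul.
  have := congr1 (fun B : 'M_n.+1 => B i i) eD; rewrite [LHS]mxE eqxx mulr1n => ->.
  by rewrite !mxE; apply: eq_bigr => k _; rewrite !mxE.
(* Eigenvalues may repeat, while interpolation nodes must be distinct. *)
have [p hp] := poly_interpolation (@Num.sqrt R) (undup_uniq [seq d i | i <- enum 'I_n.+1]).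
have {}hp i : p.[d i] = Num.sqrt (d i).
  by apply: hp; rewrite mem_undup map_f // mem_enum.
have [S hS] : exists S : 'rV_n.+1, forall i, S 0 i = toC (Num.sqrt (d i)).
  by exists (\row_i toC (Num.sqrt (d i))) => i; rewrite mxE.
have [T eT] : exists T, map_mx toC T = invmx P *m diag_mx S *m P.
  exists (horner_mx L p); have e1 := map_horner_mx toC L p; apply: etrans e1 _.
  have e2 := horner_mx_uconjC (map_poly toC p) (diag_mx sp) Pun.
  rewrite -eA eL in e2; apply: etrans e2 _; rewrite horner_mx_diag.
  apply: (congr1 (fun s => invmx P *m diag_mx s *m P)).
  by apply/rowP => i; rewrite hS mxE (hd i).2 horner_map hp.
have Sc : map_mx Num.conj S = S by apply/rowP => i; rewrite mxE hS conj_toC.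
have sT : T^T = T.
  apply: map_toC_inj; rewrite -map_trmx -[in LHS]conj_map_toC map_trmx eT Pi.
  rewrite !trmx_mul !map_mxM /= tr_diag_mx map_diag_mx -mulmxA.
  by apply: (congr1 (mulmx _)); apply: congr2; [apply: congr1|apply: trmxCK].
exists T; last first.
  apply: map_toC_inj; have e1 := map_mxM toC T T; apply: etrans e1 _.
  have e2 := etrans (congr2 mulmx eT eT) (mulmx_conj_sqr _ Pun).
  apply: etrans e2 _; rewrite mulmx_diag.
  apply: (etrans _ (etrans (esym eA) eL)).
  apply: (congr1 (fun s => invmx P *m diag_mx s *m P)); apply/rowP => i.
  by rewrite mxE !hS (hd i).2 -rmorphM -expr2 sqr_sqrtr // (hd i).1.
(* In the eigenbasis the form of [T] at [v] is a combination of squared moduli with the nonnegative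
   weights [Num.sqrt (d i)]. *)
split=> // v; rewrite -toC_le rmorph0.
have [w ew] : exists w, w = map_mx toC v *m P^t* by eexists.
have ewt : w^t* = P *m (map_mx toC v)^T.
  by rewrite ew trmx_mul map_mxM trmxCK -map_trmx conj_map_toC.
have -> : toC ((v *m T *m v^T) 0 0) = (w *m diag_mx S *m w^t*) 0 0.
  have -> : w *m diag_mx S *m w^t* =
      map_mx toC v *m (invmx P *m diag_mx S *m P) *m (map_mx toC v)^T.
    by rewrite ewt ew -Pi !mulmxA.
  by rewrite -eT map_trmx -!map_mxM [RHS]mxE.
rewrite mxE; apply: sumr_ge0 => k _; rewrite mul_mx_diag !mxE mulrAC hS.
by rewrite mulr_ge0 ?mul_conjC_ge0 // -(rmorph0 toC) toC_le sqrtr_ge0.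
Qed.

End PsdSqrt.

Lemma mulmx_col_sum (A : pzRingType) l (a : 'cV[A]_l) (p : 'rV[A]_l) :
  a *m p = \sum_i delta_mx i 0 *m (a i 0 *: p).
Proof.
apply/matrixP => i j; rewrite summxE (bigD1 i) //= big1 => [|k ki].
  by rewrite !mxE !big_ord1 !mxE !eqxx mul1r addr0.
by rewrite !mxE big_ord1 !mxE eq_sym (negbTE ki) mul0r.
Qed.

(** * The real radical *)

Section RealRadical.
Context {R : realType} {g l : nat}.
Local Notation row := 'rV[ncpoly R g]_l.
Local Notation sqr := 'M[ncpoly R g]_l.
Implicit Types (I J : set row) (X : sqr).

Lemma mulspan0 m k n (X : set 'M[ncpoly R g]_(m, k)) (Y : set 'M[ncpoly R g]_(k, n)) :
  mulspan X Y 0.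
Proof. by exists [::]; rewrite big_nil. Qed.

Lemma mulspanD m k n (X : set 'M[ncpoly R g]_(m, k)) (Y : set 'M[ncpoly R g]_(k, n)) p q :
  mulspan X Y p -> mulspan X Y q -> mulspan X Y (p + q).
Proof.
move=> [s [hs ->]] [t [ht ->]]; exists (s ++ t); rewrite big_cat; split=> // x.
by rewrite mem_cat => /orP[/hs|/ht].
Qed.

Lemma mulspan_sub m k n (X X' : set 'M[ncpoly R g]_(m, k)) (Y Y' : set 'M[ncpoly R g]_(k, n)) :
  X `<=` X' -> Y `<=` Y' -> mulspan X Y `<=` mulspan X' Y'.
Proof.
by move=> XX YY p [s [hs ->]]; exists s; split=> // t /hs[h1 h2]; split; [apply: XX|apply: YY].
Qed.

Lemma real_span_sub I J : I `<=` J -> real_span I `<=` real_span J.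
Proof.
move=> IJ p [u [v [hu hv ->]]]; exists u, v; split=> //.
  exact: mulspan_sub hu.
apply: mulspan_sub hv => // _ [q hq <-]; exists q => //; exact: IJ.
Qed.

(** Constant columns suffice in [real_span]: write [a] as the sum of the columns [e_i a_i] and let
    the left module absorb [a_i]. *)
Lemma mulspan_cst I (a : 'M[ncpoly R g]_(l, 1)) (p : row) : left_module I -> I p ->
  mulspan (range (@cst R g l 1)) I (a *m p).
Proof.
move=> hI hp; rewrite mulmx_col_sum; apply: (big_ind (mulspan _ _)) => [||i _].
- exact: mulspan0.
- by move=> *; apply: mulspanD.
exists [:: (1, cst (delta_mx i 0), a i 0 *: p)]; split=> [t|].
  rewrite inE => /eqP -> /=; split; first by exists (delta_mx i 0).
  exact: (left_moduleZ _ hI).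
rewrite big_seq1 /= rmorph1 scale1r; apply: (congr1 (mulmx^~ _)).
by apply/esym; apply: (map_delta_mx (@mkmalgU (word g) R one)).
Qed.

Lemma mulspan_adj I X : mulspan (range (@cst R g l 1)) I X ->
  mulspan (@adj R g 1 l @` I) (range (@cst R g 1 l)) (adj X).
Proof.
move=> [s [hs ->]]; exists [seq (t.1.1, adj t.2, adj t.1.2) | t <- s]; split=> [t|].
  move=> /mapP[x /hs[[B _ eB] h2] ->] /=; split; first by exists x.2.
  by exists B^T => //; rewrite -eB adj_cst.
rewrite adj_sum big_map; apply: eq_bigr => x _ /=.
by rewrite adjZC adjM.
Qed.

Lemma Ppoly_real_span (G : seq row) alpha : real_span (module_gen [set` G]) (Ppoly G alpha).
Proof.
pose u : sqr := \sum_(t <- G) adj (Defs.qpoly G alpha t) *m t.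
have hu : mulspan (range (@cst R g l 1)) (module_gen [set` G]) u.
  rewrite /u big_seq; apply: (big_ind (mulspan _ _)) => [||t ht].
  - exact: mulspan0.
  - by move=> *; apply: mulspanD.
  - by apply: mulspan_cst; [apply: module_gen_module|apply: sub_module_gen].
exists u, (adj u); split=> //; first exact: mulspan_adj.
rewrite /Ppoly /u adj_sum -big_split; apply: eq_bigr => t _ /=.
by apply: congr2 => //; rewrite adjM adjK.
Qed.

Lemma real_radical_module I : left_module (real_radical I).
Proof.
split=> [J [[[]]]//|a p q hp hq J hJ].
by case: (hJ) => -[[_ h] _] _; apply: h; [apply: hp|apply: hq].
Qed.

Lemma real_radical_real I : real_module (real_radical I).
Proof.
move=> ps hps p hp J [[mJ rJ] IJ]; apply: (rJ ps) => //.
by apply: real_span_sub hps => q; apply; split.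
Qed.

Lemma sub_real_radical I : I `<=` real_radical I.
Proof. by move=> p hp J [_]; apply. Qed.

Lemma real_radical_sub I J : left_module J -> real_module J -> I `<=` J ->
  real_radical I `<=` J.
Proof. by move=> mJ rJ IJ p; apply. Qed.

End RealRadical.

Section DegreeRows.
Context {R : realType} {g l : nat}.

Lemma degP m n (p : 'M[ncpoly R g]_(m, n)) d :
  (deg p <= d)%N <-> forall i j w, w \in msupp (p i j) -> (size w <= d)%N.
Proof.
split=> [h i j w hw|h].
  apply: leq_trans h; rewrite /deg.
  apply: leq_trans (leq_bigmax i); apply: leq_trans (leq_bigmax j).
  by rewrite (big_rem w) //= leq_maxl.
apply/bigmax_leqP => i _; apply/bigmax_leqP => j _.
by rewrite big_seq; elim/big_ind: _ => // [x y hx hy|w hw]; [rewrite geq_max hx hy|apply: h hw].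
Qed.

Lemma deg_rowP (p : 'rV[ncpoly R g]_l) d :
  (deg p <= d)%N <-> forall m, m \in supp p -> (size m.1 <= d)%N.
Proof.
apply: (iff_trans (degP _ _)); split=> [h m|h i j w hw].
  by rewrite mem_supp /coef mcoeff_neq0; apply: h.
by apply: (h (w, j)); rewrite mem_supp /coef mcoeff_neq0 /= -(ord1 i).
Qed.

End DegreeRows.

(** * Invariants of the algorithm *)

Section ReducedSeq.
Context {R : realType} {g l : nat}.
Variable le : rel (mono g l).
Hypothesis hle : is_deglex le.
Local Notation row := 'rV[ncpoly R g]_l.
Implicit Types (p q : row) (G : seq row).

(** What the interreduction loop guarantees on exit: monic elements and no reduction left to
    perform. *)
Definition redseq G := (forall p, p \in G -> lc le p = 1) /\ forall j red, ~ reduction le G j red.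

Lemma redseq_leads G : redseq G -> exists L : 'I_(size G) -> mono g l,
  [/\ forall i : 'I_(size G), lm le (G`_i) = Some (L i),
      forall i : 'I_(size G), coef (L i) (G`_i) = 1 &
      forall (i j : 'I_(size G)) t, i != j -> t \in supp (G`_j) -> ~ rdivides (L i) t].
Proof.
move=> [h1 h2].
have /choice[L hL] : forall i : 'I_(size G), exists m, lm le (G`_i) = Some m.
  by move=> i; apply: lc1_lm; apply: h1; rewrite mem_nth.
exists L; split=> // [i|i j t ij ht [w et]].
  by rewrite -(lcE (hL i)) h1 // mem_nth.
apply: (h2 j (<< coef t G`_j *g w >> *: G`_i)); exists i, (L i), w, t; split=> //.
by move=> e; case/eqP: ij; apply: ord_inj.
Qed.

(** Reductions are indexed by positions, so a repeated element could be reduced by its copy. *)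
Lemma redseq_uniq G : redseq G -> uniq G.
Proof.
move=> hG; have [L [hL _ hr]] := redseq_leads hG.
apply/(uniqP 0) => i j hi hj e; apply: contrapT => /eqP ij.
apply: (hr (Ordinal hi) (Ordinal hj) (L (Ordinal hi))) => //.
  by rewrite /= -e; apply: (lm_mem hle (hL (Ordinal hi))).
exact: rdivides_refl.
Qed.

Lemma mem_chips G m : m \in chips G <->
  exists p t s, [/\ p \in G, t \in supp p, s <> one & t = mono_mul s m].
Proof.
rewrite /chips mem_undup; split=> [/flattenP[_ /mapP[p hp ->]]|[p [t [s [hp ht s1 e]]]]].
  move=> /flattenP[_ /mapP[t ht ->] /mem_proper_divisors[s s1 e]].
  by exists p, t, s.
apply/flattenP; exists (flatten (map (@proper_divisors g l) (supp p))); first exact: map_f.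
apply/flattenP; exists (proper_divisors t); first exact: map_f.
by apply/mem_proper_divisors; exists s.
Qed.

Lemma chip_mem_chips G m : chip (fun i : 'I_(size G) => G`_i) m <-> m \in chips G.
Proof.
rewrite mem_chips; split=> [[i [t [s [ht s1 e]]]]|[p [t [s [hp ht s1 e]]]]].
  by exists G`_i, t, s; split=> //; rewrite mem_nth.
have lt : (index p G < size G)%N by rewrite index_mem.
by exists (Ordinal lt), t, s; split=> //=; rewrite nth_index.
Qed.

Lemma redseq_lm G p : redseq G -> module_gen [set` G] p -> p <> 0 ->
  exists q m w, [/\ q \in G, lm le q = Some m & lm le p = Some (mono_mul w m)].
Proof.
move=> /redseq_leads[L [h1 h2 h3]] /module_genP[a e] nz.
have [|i [w ew]] := lm_lcomb hle h1 h2 h3 (a := a); first by rewrite -e.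
by exists G`_i, (L i), w; rewrite mem_nth // h1 e.
Qed.

Lemma redseq_chip_nonlead G m p (q : mono g l) : redseq G -> m \in chips G -> p \in G ->
  lm le p = Some q -> ~ rdivides q m.
Proof.
move=> /redseq_leads[L [h1 h2 h3]] /chip_mem_chips hm hp e.
have lt : (index p G < size G)%N by rewrite index_mem.
have nl : nonlead L m := chip_nonlead hle h1 h3 hm.
have := nl (Ordinal lt).
by have := h1 (Ordinal lt); rewrite /= nth_index // e => -[->].
Qed.

(** By [redseq_lm], the leading monomial of any nonzero element of the module is a left multiple of
    one in [G]. *)
Lemma redseq_gb G : redseq G ->
  reduced_left_gb le (module_gen [set` G]) [set` G].
Proof.
move=> hG; split; last first.
  have [L [h1 h2 h3]] := redseq_leads hG.
  split=> [p|p q m t /= hp hq pq e ht]; first by case: hG => + _; apply.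
  have hi : (index p G < size G)%N by rewrite index_mem.
  have hj : (index q G < size G)%N by rewrite index_mem.
  have := h1 (Ordinal hi); rewrite /= nth_index // e => -[->].
  apply: (h3 _ (Ordinal hj)); last by rewrite /= nth_index.
  apply/eqP => -[eij]; apply: pq.
  by rewrite -(nth_index 0 hp) eij nth_index.
split; first exact: sub_module_gen.
apply/seteqP; split; apply: module_gen_sub_gen => v [p [m [hp e ->]]].
  by apply: sub_module_gen; exists p, m; split=> //; apply: sub_module_gen.
have /eqP p0 := lm_neq0 hle e.
have [q [m' [w [hq e1 e2]]]] := redseq_lm hG hp p0.
have -> : m = mono_mul w m' by move: e; rewrite e2 => -[].
have -> : mono_vec (mono_mul w m') = << 1%R *g w >> *: mono_vec m' :> row.
  by apply: etrans (esym (mono_vecZ _ _ _)); rewrite rmorph1 scale1r.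
apply: (left_moduleZ _ (module_gen_module _)); apply: sub_module_gen.
by exists q, m'.
Qed.

Lemma redseq_real G : redseq G ->
  (forall (rs : seq row) alpha,
    (forall p m, p \in rs -> m \in supp p -> m \in chips G) ->
    \sum_(p <- rs) adj p *m p = Ppoly G alpha -> forall p, p \in rs -> p = 0) ->
  real_module (module_gen [set` G]).
Proof.
move=> hG nosos; have [L [h1 h2 h3]] := redseq_leads hG.
apply: (no_sos_real hle h1 h2 h3) => rs f rsC fC E.
(* [alpha] is indexed by rows rather than positions. Since [G] has no repetition, the position is
   recovered from the row. *)
pose F (t : row) : row := if insub (index t G) is Some i then f i else 0.
have FE (i : 'I_(size G)) : F G`_i = f i.
  by rewrite /F index_uniq // ?redseq_uniq // valK.
have FC (i : 'I_(size G)) m : m \in supp (F G`_i) -> m \in chips G.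
  by rewrite FE => /fC /chip_mem_chips.
apply: (nosos rs (fun m t => coef m (F t))) => [p m hp hm|].
  by apply/chip_mem_chips; apply: rsC hm.
apply: etrans E _; rewrite /Ppoly (big_nth 0) big_mkord; apply: eq_bigr => i _.
have e := etrans (qpoly_coefs (FC i)) (FE i).
by apply: congr2; [apply: (congr1 (fun q => adj q *m _))|apply: (congr1 (mulmx _))]; apply/esym.
Qed.

(** Constants have no proper divisors, so there are no chips and every row supported on chips is
    zero. *)
Lemma redseq_constant_real G : redseq G -> (forall p, p \in G -> deg p = 0%N) ->
  real_module (module_gen [set` G]).
Proof.
move=> hG h0; apply: redseq_real => // rs alpha rsC _ p hp.
apply/eqP; rewrite -supp_eq0; case e : supp => [//|m s].
have /mem_chips[q [t [u [hq ht u1 et]]]] : m \in chips G.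
  by apply: (rsC p) => //; rewrite e mem_head.
have /deg_rowP/(_ t ht) : (deg q <= 0)%N by rewrite h0.
rewrite et size_mono_mul leqn0 addn_eq0 size_word_eq0.
by case: eqP.
Qed.

Lemma lm_scale c p : c != 0 -> lm le (c%:MP *: p) = lm le p.
Proof.
move=> c0; case: (pselect (p = 0)) => [->|p0]; first by rewrite scaler0.
have [m hm] := lm_exists hle p0; rewrite hm; apply/lm_some => //.
have [h1 h2] := (lm_some hle _ _).1 hm.
by split=> [|t]; rewrite suppZC_neq0 //; apply: h2.
Qed.

Lemma mem_normalize G p :
  p \in normalize le G <-> exists q, [/\ q \in G, q != 0 & p = (lc le q)^-1%:MP *: q].
Proof.
split=> [/mapP[q]|[q [h1 h2 ->]]].
  by rewrite mem_filter => /andP[h1 h2] ->; exists q.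
by apply/mapP; exists q => //; rewrite mem_filter h2.
Qed.

Lemma lc_normalize G p : p \in normalize le G -> lc le p = 1.
Proof.
move=> /mem_normalize[q [_ q0 ->]]; have c0 := lc_neq0 hle q0.
have /eqP/(lm_exists hle)[m hm] := q0.
rewrite (lcE (m := m)); last by rewrite lm_scale ?invr_eq0.
by rewrite rcoefZ -(lcE hm) mulVf.
Qed.

Lemma module_normalize G : module_gen [set` normalize le G] = module_gen [set` G].
Proof.
apply/seteqP; split; apply: module_gen_sub_gen => p /=.
  move=> /mem_normalize[q [hq _ ->]]; apply: (left_moduleZ _ (module_gen_module _)).
  exact: sub_module_gen.
move=> hp; case: (eqVneq p 0) => [->|p0]; first by case: (module_gen_module [set` normalize le G]).
have c0 := lc_neq0 hle p0.
have -> : p = (lc le p)%:MP *: ((lc le p)^-1%:MP *: p).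
  by rewrite scalerA -rmorphM mulfV // rmorph1 scale1r.
apply: (left_moduleZ _ (module_gen_module _)); apply: sub_module_gen.
by apply/mem_normalize; exists p.
Qed.

(** A reduction is undone by adding the same multiple of element [i] back, because position [i]
    differs from [j] and is left untouched. *)
Lemma module_reduce G j red : reduction le G j red ->
  module_gen [set` set_nth 0 G j (G`_j - red)] = module_gen [set` G].
Proof.
move=> [i [m [w [t [hi hj ij _ [_ _ ->]]]]]].
set a := << _ *g w >>; set G' := set_nth _ _ _ _.
have sz : size G' = size G by rewrite size_set_nth; apply/maxn_idPr.
have nG' k : G'`_k = if k == j then G`_j - a *: G`_i else G`_k by rewrite nth_set_nth.
have mI (H : seq row) k : (k < size H)%N -> module_gen [set` H] H`_k.
  by move=> hk; apply: sub_module_gen; rewrite /= mem_nth.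
have mm (H : seq row) := module_gen_module [set` H].
apply/seteqP; split; apply: module_gen_sub_gen => p /= /(nthP 0)[k hk <-].
  rewrite nG'; case: eqP => _; last by apply: mI; rewrite -sz.
  by apply: (left_moduleB (mm G)); [apply: mI|apply: (left_moduleZ _ (mm G)); apply: mI].
case: (eqVneq k j) => [->|kj].
  have -> : G`_j = G'`_j + a *: G'`_i.
    by rewrite !nG' eqxx; case: eqP => // _; rewrite subrK.
  by apply: (left_moduleD (mm G')); [|apply: (left_moduleZ _ (mm G'))]; apply: mI; rewrite sz.
have -> : G`_k = G'`_k by rewrite nG' (negbTE kj).
by apply: mI; rewrite sz.
Qed.

Lemma step_module_sub (s s' : @state R g l) : step le s s' ->
  module_gen [set` basis s] `<=` module_gen [set` basis s'].
Proof.
case=> [G|G j red hr|G _|G _|D _ _|D S k _|D S _ _|D S _ _|D S a z T _ _ _ _|G|G phis] /=;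
  try exact: subset_refl.
- by rewrite module_normalize.
- by rewrite (module_reduce hr).
- by apply: module_gen_sub_gen => p hp; apply: sub_module_gen; rewrite /= mem_cat hp.
Qed.

End ReducedSeq.

(** * Partial correctness: the module stays between [I] and its real radical *)

Section Correctness.
Context {R : realType} {g l : nat}.
Variable le : rel (mono g l).
Hypothesis hle : is_deglex le.
Local Notation row := 'rV[ncpoly R g]_l.
Local Notation state := (@state R g l).
Local Notation pencil := (@pencil R g l).
Variable iotas : seq row.
Let I0 := module_gen [set` iotas].
Let RR := real_radical I0.

(** An answer no longer carries its pencil, so it records what was learnt from it: realness if the
    search failed; otherwise rows of the radical, supported on chips and not all zero. The first two
    of these serve correctness and progress of the basis, the last the strict growth of the
    module. *)
Definition phase_inv (s : state) : Prop :=
  match s with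
  | Normalize G => True
  | Interreduce G => forall p, p \in G -> lc le p = 1
  | Test G => redseq le G
  | Facial D K => [/\ redseq le (gens D), valid_pencil D & facial_inv K]
  | Answer G None => redseq le G /\ real_module (module_gen [set` G])
  | Answer G (Some phis) =>
      [/\ redseq le G, [set` phis] `<=` RR, (exists2 p, p \in phis & p <> 0) &
          forall p m, p \in phis -> m \in supp p -> m \in chips G]
  | Output G => redseq le G /\ real_module (module_gen [set` G])
  end.

Definition run_inv (s : state) : Prop :=
  [/\ I0 `<=` module_gen [set` basis s], module_gen [set` basis s] `<=` RR & phase_inv s].

Lemma no_solution_real (D : pencil) (S : {set 'I_(size (monos D))}) :
  redseq le (gens D) -> valid_pencil D -> facial_inv S ->
  (forall alpha zeta, ~ lmi_solution S alpha zeta) ->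
  real_module (module_gen [set` gens D]).
Proof.
move=> hG hD hS nosol; apply: (redseq_real hle hG) => rs alpha rsC E.
exact: (no_solution_no_sos hD hS nosol rsC E).
Qed.

(** For symmetric [T] the diagonal entry of [T T] is the sum of the squares of row [k]. *)
Lemma sqr_sym_diag0 n (T : 'M[R]_n) k : T^T = T -> (T *m T) k k = 0 -> forall j, T k j = 0.
Proof.
move=> sT; rewrite mxE => h j.
have : \sum_i T k i ^+ 2 = 0.
  apply: etrans h; apply: eq_bigr => i _; rewrite expr2; apply: (congr1 ( *%R _)).
  by rewrite -[in LHS]sT mxE.
move/eqP; rewrite psumr_eq0 => [/allP/(_ j)|i _]; last exact: sqr_ge0.
by rewrite mem_index_enum /= sqrf_eq0 => /(_ isT)/eqP.
Qed.

Lemma solution_inv (D : pencil) (S : {set 'I_(size (monos D))}) alpha zeta T :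
  redseq le (gens D) -> valid_pencil D -> module_gen [set` gens D] `<=` RR ->
  lmi_solution S alpha zeta -> psd T -> T *m T = Lmx D alpha zeta ->
  phase_inv (Answer (gens D)
    (Some [seq matrix.row k (cst T *m column (monos D)) | k <- enum S])).
Proof.
move=> hG hD GR [[sP fS] _ nz] [sT _] eT.
pose F k : row := matrix.row k (cst T *m column (monos D)).
have RF k : RR (F k).
  (* All rows enter the sum, also those outside [S], so that it equals the full Gram polynomial
     [P]. *)
  apply: (@real_radical_real _ _ _ I0 (map F (enum 'I_(size (monos D))))); last first.
    by apply: map_f; rewrite mem_enum.
  apply: (real_span_sub GR); rewrite big_map.
  have -> : \sum_(j <- enum 'I_(size (monos D))) adj (F j) *m F j = Ppoly (gens D) alpha.
    rewrite big_enum /= -(gram_mul_tr T) sT eT; exact: gram_Lmx.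
  exact: Ppoly_real_span.
split=> //.
- by move=> _ /= /mapP[k _ ->]; apply: RF.
(* [L] is nonzero, so [T] has a nonzero row. Its index lies in [S], since outside [S] the diagonal
   of [L = T T] vanishes and the row of [T] with it. *)
- have [k [a Tka]] : exists k a, T k a <> 0.
    apply: contrapT => /forallNP h; case/eqP: nz; rewrite -eT.
    have -> : T = 0; last by rewrite mul0mx.
    by apply/matrixP => k a; rewrite mxE; apply: contrapT => hka; apply: (h k); exists a.
  exists (F k).
    apply: map_f; rewrite mem_enum; apply: contrapT => /negP kS; apply: Tka.
    by apply: sqr_sym_diag0 => //; rewrite eT fS // (negbTE kS).
  move=> Fk; apply: Tka; rewrite -(coef_cst_column T k a (monos_uniq hD)).
  by move: Fk; rewrite /F => ->; rewrite raddf0.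
- move=> _ m /mapP[k _ ->] /supp_cst_column; exact: monos_chips.
Qed.

Lemma run_inv_step s s' : step le s s' -> run_inv s -> run_inv s'.
Proof.
move=> st [lo hi ph]; split; first exact: subset_trans lo (step_module_sub hle st).
  case: st hi ph {lo} => [G|G j red hr|G _|G _|D _ _|D S k _|D S _ _|D S _ _|
    D S a z T _ _ _ _|G|G phis] //= hi.
  - by rewrite module_normalize.
  - by rewrite (module_reduce hr).
  - case=> _ hR _ _; apply: module_gen_sub => [|p /=]; first exact: real_radical_module.
    rewrite mem_cat => /orP[hp|]; last exact: hR.
    by apply: hi; apply: sub_module_gen.
case: st ph hi {lo} => [G|G j red hr|G h|G h|D _ hD|D S k hk|D S _ h|D S _ h|
  D S a z T _ sol pT eT|G|G phis] //=.
- by move=> _ _ p; apply: lc_normalize.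
- by move=> hG _; split=> //; apply: (redseq_constant_real hle hG).
- by move=> hG _; split=> //; apply: facial_invT.
- by move=> [hG hD hS] _; split=> //; apply: facial_invD1.
- move=> [hG hD hS] _; split=> //; apply: no_solution_real hS _ => // alpha zeta.
  by move=> [f _]; rewrite h // eqxx.
- by move=> [hG hD hS] _; split=> //; apply: no_solution_real hS _.
- by move=> [hG hD hS] hi; apply: (solution_inv hG hD hi sol).
Qed.

Lemma reachable_inv (P : state -> Prop) s s' :
  (forall s s', step le s s' -> P s -> P s') -> reachable le s s' -> P s -> P s'.
Proof.
move=> h; elim=> [x y /h//|//|x y z _ h1 _ h2 hx]; exact: h2 (h1 hx).
Qed.

Lemma run_inv_reachable s : reachable le (Normalize iotas) s -> run_inv s.
Proof.
move=> h; apply: reachable_inv h _; first exact: run_inv_step.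
by split=> //=; apply: sub_real_radical.
Qed.

Lemma output_correct G : reachable le (Normalize iotas) (Output G) ->
  reduced_left_gb le (real_radical I0) [set` G].
Proof.
move=> /run_inv_reachable[/= lo hi [hG rG]].
have -> : real_radical I0 = module_gen [set` G].
  apply/seteqP; split=> //; apply: real_radical_sub => //; exact: module_gen_module.
exact: redseq_gb.
Qed.

End Correctness.

(** * Progress: only outputs have no successor *)

Section Progress.
Context {R : realType} {g l : nat}.
Variable le : rel (mono g l).
Hypothesis hle : is_deglex le.
Local Notation row := 'rV[ncpoly R g]_l.
Local Notation state := (@state R g l).
Local Notation pencil := (@pencil R g l).

(** Among the subspaces contained in [P], one of maximal dimension is all of [P]: adjoining a vector
    of [P] stays inside [P], so it cannot raise the dimension. *)
Lemma subspace_exists (V : vectType R) (P : V -> Prop) :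
  P 0 -> (forall c u v, P u -> P v -> P (c *: u + v)) ->
  exists X : seq V, free X /\ forall v, v \in <<X>>%VS <-> P v.
Proof.
move=> P0 PD.
have : exists2 U : {vspace V}, (forall v, v \in U -> P v) & forall U' : {vspace V},
    (forall v, v \in U' -> P v) -> (\dim U' <= \dim U)%N.
  pose Q k := `[< exists2 U : {vspace V}, (forall v, v \in U -> P v) & \dim U = k >].
  have exQ : exists k, Q k.
    by exists 0%N; apply/asboolP; exists 0%VS; rewrite ?dimv0 // => v; rewrite memv0 => /eqP ->.
  have bQ k : Q k -> (k <= \dim {:V})%N.
    by move=> /asboolP[U _ <-]; apply: dimvS; apply: subvf.
  case: (ex_maxnP exQ bQ) => k /asboolP[U hU <-] kmax; exists U => // U' hU'.
  by apply: kmax; apply/asboolP; exists U'.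
move=> [U hU Umax]; exists (vbasis U); split; first exact: (basis_free (vbasisP U)).
move=> v; rewrite (span_basis (vbasisP U)); split; first exact: hU.
move=> Pv; have hU' w : w \in (U + <[v]>)%VS -> P w.
  by move=> /memv_addP[u /hU Pu [_ /vlineP[c ->] ->]]; rewrite addrC; apply: PD.
have := Umax _ hU'; rewrite (geq_leqif (dimv_leqif_sup (addvSl U <[v]>%VS))).
rewrite subv_add subvv /=.
by rewrite -memvE.
Qed.

(** The coefficient of each monomial is spread evenly over the [N a b] Gram entries that contribute
    to it. The count is invariant under exchanging [a] and [b], so [B] inherits symmetry from
    [p]. *)
Lemma gram_exists (M : seq (mono g l)) (p : 'M[ncpoly R g]_l) : adj p = p ->
  exists2 B : 'M[R]_(size M), B^T = B &
    forall i j w, (i, j, w) \in star_products M -> (gram B i j)@_w = (p i j)@_w.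
Proof.
move=> sp; pose N (a b : 'I_(size M)) : R :=
  \sum_(c < size M) \sum_(d < size M) (star_at (M := M) c d == star_at a b)%:R.
pose B : 'M[R]_(size M) := \matrix_(a, b) (scoef (mono_at a) (mono_at b) p / N a b).
exists B => [|i j w /star_productsP[a [b [ei ej ew]]]].
  apply/matrixP => a b; rewrite !mxE -scoef_adj sp; apply: (congr1 (fun x => _ / x)).
  rewrite /N exchange_big; apply: eq_bigr => c _; apply: eq_bigr => d _.
  by rewrite star_at_sym.
have N0 : N a b != 0.
  apply: lt0r_neq0; rewrite /N (bigD1 a) //= (bigD1 b) //= eqxx.
  rewrite -addrA ltr_wpDr // ?addr_ge0 ?sumr_ge0 // => c _.
  by apply: sumr_ge0 => d _; apply: ler0n.
rewrite gram_coef (_ : (i, j, w) = star_at a b); last by rewrite ei ej ew.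
have -> : (p i j)@_w = scoef (mono_at a) (mono_at b) p by rewrite ei ej ew.
transitivity (\sum_(c < size M) \sum_(d < size M)
    (scoef (mono_at a) (mono_at b) p / N a b) * (star_at (M := M) c d == star_at a b)%:R).
  apply: eq_bigr => c _; apply: eq_bigr => d _; rewrite mxE -mulr_natr.
  case: eqP => [e|_]; last by rewrite !mulr0.
  rewrite !mulr1; apply: (congr2 (fun x y : R => x / y)).
    by move: e => [e1 e2 e3]; rewrite /scoef e1 e2 e3.
  by rewrite /N e.
under eq_bigr => c _ do rewrite -mulr_sumr.
by rewrite -mulr_sumr -/(N a b) divfK.
Qed.

Lemma pencil_exists (G : seq row) : exists2 D : pencil, gens D = G & valid_pencil D.
Proof.
pose M := chips G.
have [|c U V [sU gU] [sV gV]|Zs [frZ memZ]] :=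
    @subspace_exists 'M[R]_(size M) (fun Z => Z^T = Z /\ gram Z = 0).
- by rewrite trmx0 gram0.
- by rewrite linearP /= sU sV gramD gramZ gU gV scaler0 addr0.
have /choice[B hB] : forall mt : mono g l * row, exists B : 'M[R]_(size M), B^T = B /\
    forall i j w, (i, j, w) \in star_products M -> (gram B i j)@_w =
      ((adj (mono_vec mt.1) *m mt.2 + adj mt.2 *m mono_vec mt.1) i j)@_w.
  move=> [m t]; have [|B h1 h2] := @gram_exists M (adj (mono_vec m) *m t + adj t *m mono_vec m).
    rewrite adjD addrC; apply: congr2; by rewrite adjM adjK.
  by exists B.
exists (Pencil G Zs (fun m t => B (m, t))) => //; split=> //=.
(* All chips are kept, so both admissibility conditions are immediate. *)
by split=> [|alpha //]; exists 0%N; rewrite (eq_filter (a2 := predT)) ?filter_predT //.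
Qed.

Lemma step_exists (iotas : seq row) s : run_inv le iotas s -> (forall s', ~ step le s s') ->
  exists G, s = Output G.
Proof.
move=> [_ _ ph] stuck; case: s ph stuck => [G|G|G|D K|G [phis|]|G] /=.
- by move=> _ /(_ _ (Step_normalize le G)).
- move=> _ stuck; exfalso; apply: (stuck (Test G)); apply: Step_reduced => j red hr.
  exact: (stuck _ (Step_reduce hr)).
- move=> _ stuck; exfalso.
  case: (pselect (forall p, p \in G -> deg p = 0%N)) => h.
    exact: (stuck _ (Step_constant _ h)).
  have [D eD hD] := pencil_exists G; subst G.
  exact: (stuck _ (Step_pencil _ h hD)).
- move=> [_ hD _] stuck; exfalso.
  case: (pselect (exists k, zero_diag K k)) => [[k hk]|/forallNP nk].
    exact: (stuck _ (Step_delete _ hk)).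
  case: (pselect (exists az, lmi_solution K az.1 az.2)) => [[[a z] /= sol]|/forallNP nos].
    have [_ pL _] := sol; have [T pT eT] := psd_sqrt pL.
    exact: (stuck _ (Step_solution _ nk sol pT eT)).
  by apply: (stuck _ (Step_nosolution _ nk (fun a z => nos (a, z)))).
- by move=> _ /(_ _ (Step_continue le G phis)).
- by move=> _ /(_ _ (Step_stop le G)).
- by exists G.
Qed.

End Progress.

(** * Degrees and termination *)

Lemma sum_uniq_sub (T : eqType) (s s' : seq T) (f : T -> nat) :
  uniq s -> uniq s' -> {subset s <= s'} ->
  (\sum_(x <- s) f x <= \sum_(x <- s') f x)%N.
Proof.
move=> us us' ss'; have pe : perm_eq s [seq x <- s' | x \in s].
  apply: uniq_perm => //; first exact: filter_uniq.
  by move=> x; rewrite mem_filter; case: (boolP (x \in s)) => // /ss' ->.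
rewrite (perm_big _ pe) big_filter big_mkcond; apply: leq_sum => x _.
by case: ifP.
Qed.

Lemma sum_pow2 r : (\sum_(k <- iota 0 r) 2 ^ k < 2 ^ r)%N.
Proof.
elim: r => [|r ih]; first by rewrite big_nil.
have -> : iota 0 r.+1 = iota 0 r ++ [:: r] by rewrite -[r.+1]addn1 iotaD.
by rewrite big_cat big_seq1 expnS mul2n -addnn ltn_add2r.
Qed.

(** Distinct exponents below [r] spell a binary number with at most [r] digits. *)
Lemma sum_pow2_lt (T : eqType) (s : seq T) (rk : T -> nat) r :
  uniq s -> {in s &, injective rk} -> (forall x, x \in s -> (rk x < r)%N) ->
  (\sum_(x <- s) 2 ^ rk x < 2 ^ r)%N.
Proof.
move=> us inj lt; apply: leq_ltn_trans (sum_pow2 r).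
rewrite -(big_map rk xpredT (fun k => 2 ^ k)%N); apply: sum_uniq_sub.
- by rewrite map_inj_in_uniq.
- exact: iota_uniq.
- by move=> _ /mapP[x /lt h ->]; rewrite mem_iota.
Qed.

Section Degrees.
Context {R : realType} {g l : nat}.
Variable le : rel (mono g l).
Hypothesis hle : is_deglex le.
Local Notation row := 'rV[ncpoly R g]_l.
Local Notation state := (@state R g l).
Implicit Types (G : seq row) (p q : row).

(** [t] is the cancelled term. As the reducing element is monic and [t] is the image of its leading
    monomial, all of [red] lies at or below [t], so degrees cannot grow. *)
Lemma reduction_supp G j red : (forall p, p \in G -> lc le p = 1) -> reduction le G j red ->
  (j < size G)%N /\ exists t,
    [/\ t \in supp G`_j, coef t red = coef t G`_j & forall x, x \in supp red -> le x t].
Proof.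
move=> lc1 [i [m [w [t [hi hj _ e [ht et ->]]]]]]; split=> //; exists t; split=> //.
  have c1 : coef m G`_i = 1 by rewrite -(lcE e) lc1 // mem_nth.
  by rewrite {1}et; apply: etrans (rcoefZU _ _ _ _) _; rewrite c1 mulr1.
by move=> x /suppZU[t' ht' ->]; rewrite et (deglex_mul hle) // (lm_max hle e).
Qed.

Definition deg_le d G := forall p m, p \in G -> m \in supp p -> (size m.1 <= d)%N.

Lemma chips_size d G m : deg_le d G -> m \in chips G -> (size m.1 < d)%N.
Proof.
move=> hG /mem_chips[p [t [s [hp ht s1 e]]]]; have := hG p t hp ht.
rewrite e size_mono_mul; apply: leq_trans.
by rewrite -[X in (X < _)%N]add0n ltn_add2r lt0n size_word_eq0; apply/eqP.
Qed.

Lemma mem_set_nth G j x p : (j < size G)%N -> p \in set_nth 0 G j x -> p = x \/ p \in G.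
Proof.
move=> hj /(nthP 0)[k]; rewrite size_set_nth (maxn_idPr _) // nth_set_nth /= => hk.
by case: eqP => _ <-; [left|right; rewrite mem_nth].
Qed.

Lemma deg_le_step d iotas s s' : run_inv le iotas s -> step le s s' ->
  deg_le d (basis s) -> deg_le d (basis s').
Proof.
move=> [_ _ ph] st.
case: st ph => [G|G j red hr|G h|G h|D _ hD|D S k hk|D S _ h|D S _ h|
  D S a z T _ sol pT eT|G|G phis] //= ph hG p m.
- by move=> /mem_normalize[q [hq _ ->]] /suppZC; apply: hG.
- have [hj [t [ht _ hx]]] := reduction_supp ph hr.
  move=> /(mem_set_nth hj)[-> /suppB[|/hx hm]|]; last exact: hG.
    by apply: hG; rewrite mem_nth.
  apply: leq_trans (deglex_size hle hm) _; apply: (hG G`_j t) => //.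
  by rewrite mem_nth.
- rewrite mem_cat => /orP[|hp hm]; first exact: hG.
  case: ph => _ _ _ hc; apply: ltnW; exact: chips_size hG (hc p m hp hm).
Qed.

(** The binary number whose digit at position [k] tells whether the monomial of rank [k] occurs in
    [p], for [p] of degree at most [d]. *)
Definition wt d p := (\sum_(t <- supp p) 2 ^ mrank le d t)%N.

Definition weight d G := (\sum_(p <- G) wt d p)%N.

(** Above [t] no monomial is created; the digit of [t] is erased; whatever appears below [t] weighs
    less than that digit. *)
Lemma wt_reduce d p red t : (forall m, m \in supp p -> (size m.1 <= d)%N) ->
  t \in supp p -> coef t red = coef t p -> (forall x, x \in supp red -> le x t) ->
  (wt d (p - red) < wt d p)%N.
Proof.
move=> hd ht et hx.
have sz x : x \in supp (p - red) -> (size x.1 <= d)%N.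
  case/suppB => [/hd//|/hx /(deglex_size hle) h]; exact: leq_trans h (hd t ht).
have nt : t \notin supp (p - red) by rewrite mem_supp rcoefB et subrr eqxx.
rewrite /wt (bigID (mlt le ^~ t)) /= -big_filter -[X in (_ + X)%N]big_filter.
rewrite [X in (_ < X)%N](bigD1_seq t) ?supp_uniq //= -[X in (_ < _ + X)%N]big_filter.
rewrite -addSn leq_add //.
  apply: sum_pow2_lt => [|x y|x]; first by rewrite filter_uniq // supp_uniq.
    rewrite !mem_filter => /andP[_ hx1] /andP[_ hy1].
    by apply: (mrank_inj hle); apply: sz.
  by rewrite mem_filter => /andP[lt hx1]; apply: mrank_lt => //; apply: sz.
apply: sum_uniq_sub; rewrite ?filter_uniq ?supp_uniq // => x.
rewrite !mem_filter => /andP[nlt hx1].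
have xt : x != t by apply: contraNneq nt => <-.
rewrite xt /=; case/suppB: hx1 => // /hx h.
by case/negP: nlt; rewrite /mlt h.
Qed.

Lemma weight_normalize d G : (weight d (normalize le G) <= weight d G)%N.
Proof.
rewrite /weight big_map big_filter.
rewrite (eq_bigr (wt d)) => [|p p0]; last first.
  apply: perm_big; apply: uniq_perm; rewrite ?supp_uniq // => m.
  by rewrite suppZC_neq0 // invr_eq0; apply: lc_neq0.
by rewrite big_mkcond; apply: leq_sum => p _; case: ifP.
Qed.

Lemma weight_reduce d G j red : deg_le d G -> (forall p, p \in G -> lc le p = 1) ->
  reduction le G j red -> (weight d (set_nth 0 G j (G`_j - red))%R < weight d G)%N.
Proof.
move=> hG lc1 hr; have [hj [t [ht et hx]]] := reduction_supp lc1 hr.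
rewrite /weight (big_nth 0) [X in (_ < X)%N](big_nth 0) !big_mkord.
rewrite size_set_nth (maxn_idPr _) //.
rewrite (bigD1 (Ordinal hj)) //= [X in (_ < X)%N](bigD1 (Ordinal hj)) //=.
rewrite nth_set_nth /= eqxx -addSn leq_add //.
  by apply: (@wt_reduce _ _ _ t) => // m; apply: hG; rewrite mem_nth.
apply: leq_sum => i ij; rewrite nth_set_nth /=.
by case: eqP => // ei; case/eqP: ij; apply: ord_inj.
Qed.

(** The outer measure: the module of the basis only grows, so this count never increases, and new
    rows [phi] lower it. *)
Definition nonleading d (s : state) := count (fun m =>
  ~~ `[< exists2 p, module_gen [set` basis s] p & lm le p = Some m >]) (monos_upto d).

Definition phase (s : state) : nat :=
  match s with
  | Normalize _ | Interreduce _ => 5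
  | Test _ => 4
  | Facial _ _ => 3
  | Answer _ _ => 2
  | Output _ => 1
  end.

(** Normalisation may leave the weight unchanged, hence the doubling: the extra 1 pays for it, and a
    reduction, lowering the weight by at least 1, gains 2 and can afford the return to
    [Normalize]. *)
Definition phase_weight d (s : state) : nat :=
  match s with
  | Normalize G => (weight d G).*2.+1
  | Interreduce G => (weight d G).*2
  | Facial D K => #|K|
  | _ => 0
  end.

Lemma nonleading_le d s s' : step le s s' -> (nonleading d s' <= nonleading d s)%N.
Proof.
move=> /(step_module_sub hle) h; apply: sub_count => m; apply: contraNN.
by move=> /asboolP[p hp e]; apply/asboolP; exists p => //; apply: h.
Qed.

Lemma nonleading_continue d iotas G phis : run_inv le iotas (Answer G (Some phis)) ->
  deg_le d G -> (nonleading d (Normalize (G ++ phis)) < nonleading d (Answer G (Some phis)))%N.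
Proof.
move=> [_ _ /= [hG _ [p hp p0] hc]] hd; have [m hm] := lm_exists hle p0.
have mc := hc p m hp (lm_mem hle hm).
apply: (@count_lt _ _ _ _ m); first 1 last.
- by apply: mem_monos_upto; apply: ltnW; apply: chips_size hd mc.
- apply/asboolPn => -[q hq eq]; have /eqP q0 := lm_neq0 hle eq.
  have [r [m' [w [hr e1 e2]]]] := redseq_lm hle hG hq q0.
  apply: (redseq_chip_nonlead hle hG mc hr e1); exists w.
  by move: eq; rewrite e2 => -[].
- rewrite negbK; apply/asboolP; exists p => //; apply: sub_module_gen.
  by rewrite /= mem_cat hp orbT.
- move=> m1; apply: contraNN => /asboolP[q hq eq]; apply/asboolP; exists q => //.
  exact: (step_module_sub hle (Step_continue le G phis)).
Qed.

(** The measures are ordered lexicographically: [nonleading], [phase], [phase_weight]. Only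
    [Step_continue] raises the phase, and it strictly lowers [nonleading]. *)
Lemma step_decreases d iotas s s' : run_inv le iotas s -> deg_le d (basis s) ->
  step le s s' ->
  (nonleading d s' < nonleading d s)%N \/
  ((nonleading d s' <= nonleading d s)%N /\
   ((phase s' < phase s)%N \/ phase s' = phase s /\ (phase_weight d s' < phase_weight d s)%N)).
Proof.
move=> inv hd st; have nl := nonleading_le d st.
case: st inv hd nl => [G|G j red hr|G h|G h|D _ hD|D S k hk|D S _ h|D S _ h|
  D S a z T _ sol pT eT|G|G phis] inv hd nl;
  try (by right; split=> //; left).
- by right; split=> //; right; split=> //=; rewrite ltnS leq_double weight_normalize.
- right; split=> //; right; split=> //=; case: inv => _ _ ph.
  by have := weight_reduce hd ph hr; rewrite -leq_double -ltnS doubleS.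
- right; split=> //; right; split=> //=.
  by rewrite [X in (_ < X)%N](cardsD1 k) hk.1.
- by left; apply: nonleading_continue inv hd.
Qed.

Lemma no_infinite_run d iotas s : run_inv le iotas s -> deg_le d (basis s) ->
  ~ exists run : nat -> state, run 0%N = s /\ forall k, step le (run k) (run k.+1).
Proof.
have [A eA] : exists A, nonleading d s = A by eexists.
have [B eB] : exists B, phase s = B by eexists.
have [C eC] : exists C, phase_weight d s = C by eexists.
elim/ltn_ind: A B C s eA eB eC => A IHA; elim/ltn_ind => B IHB; elim/ltn_ind => C IHC.
move=> s eA eB eC inv hd [run [e0 hrun]].
have st : step le s (run 1%N) by rewrite -e0.
have inv' := run_inv_step hle st inv.
have hd' := deg_le_step inv st hd.
have hrun' : exists run' : nat -> state,
    run' 0%N = run 1%N /\ forall k, step le (run' k) (run' k.+1).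
  by exists (fun k => run k.+1).
case: (step_decreases inv hd st) => [lt|[le1 h]].
  by apply: (IHA _ _ _ _ (run 1%N) erefl erefl erefl inv' hd' hrun'); rewrite -eA.
move: le1; rewrite leq_eqVlt => /orP[/eqP e1|lt]; last first.
  by apply: (IHA _ _ _ _ (run 1%N) erefl erefl erefl inv' hd' hrun'); rewrite -eA.
case: h => [lt|[e2 lt]].
  by apply: (IHB _ _ _ (run 1%N) _ erefl erefl inv' hd' hrun'); rewrite -?eB // e1.
apply: (IHC _ _ (run 1%N) _ _ erefl inv' hd' hrun'); rewrite -?eC //.
  by rewrite e1.
by rewrite e2.
Qed.

End Degrees.

(** * The degree bound *)

Section InvolvedDegree.
Context {R : realType} {g l : nat}.
Variable le : rel (mono g l).
Hypothesis hle : is_deglex le.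
Local Notation row := 'rV[ncpoly R g]_l.

Lemma deg_adjmul (p q : row) a b :
  (forall m, m \in supp p -> (size m.1 <= a)%N) ->
  (forall m, m \in supp q -> (size m.1 <= b)%N) -> (deg (adj p *m q) <= a + b)%N.
Proof.
move=> ha hb; apply/degP => i j w; rewrite -mcoeff_neq0 leqNgt; apply: contraNN => lt.
apply/eqP; apply: coef_adjmul0 => x y hx hy _ _ e.
by move: lt; rewrite -e size_sprod ltnNge leq_add ?ha ?hb.
Qed.

Lemma deg_add m n (p q : 'M[ncpoly R g]_(m, n)) d :
  (deg p <= d)%N -> (deg q <= d)%N -> (deg (p + q) <= d)%N.
Proof.
move=> /degP hp /degP hq; apply/degP => i j w; rewrite mxE.
by move=> /(fsubsetP (msuppD_le _ _)); rewrite inE => /orP[/hp|/hq].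
Qed.

Lemma deg_zero m n : deg (0 : 'M[ncpoly R g]_(m, n)) = 0%N.
Proof. by apply/eqP; rewrite -leqn0; apply/degP => i j w; rewrite mxE msupp0. Qed.

Lemma supp_qpoly (G : seq row) alpha t m : m \in supp (Defs.qpoly G alpha t) -> m \in chips G.
Proof. by case/supp_sum_seq => m' hm' /suppZC; rewrite supp_mono => /eqP ->. Qed.

Lemma involved_deg iotas d s m n (p : 'M[ncpoly R g]_(m, n)) : (0 < d)%N ->
  involved le s p -> run_inv le iotas s -> deg_le d (basis s) -> (deg p < 2 * d)%N.
Proof.
move=> d0 hp.
have dlt k : (k <= d)%N -> (k < 2 * d)%N.
  by move=> hk; apply: leq_ltn_trans hk _; rewrite mul2n -addnn -[X in (X < _)%N]addn0 ltn_add2l.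
have rowd (q : row) : (forall x, x \in supp q -> (size x.1 <= d)%N) -> (deg q < 2 * d)%N.
  by move=> h; apply: dlt; apply/deg_rowP.
(* A chip has degree at most [d.-1], so its product with a basis element or with another chip has
   degree at most [2d - 1]. *)
have d1 k : (k <= d.-1 + d)%N -> (k < 2 * d)%N.
  by move=> hk; apply: leq_ltn_trans hk _; rewrite mul2n -addnn -addSn prednK.
have cd (G : seq row) x : deg_le d G -> x \in chips G -> (size x.1 <= d.-1)%N.
  by move=> hG /(chips_size hG); rewrite -{1}(prednK d0) ltnS.
have cd' (G : seq row) x : deg_le d G -> x \in chips G -> (size x.1 <= d)%N.
  by move=> hG /(chips_size hG)/ltnW.
have qd (G : seq row) alpha (t : row) : deg_le d G -> t \in G ->
    (deg (adj (Defs.qpoly G alpha t) *m t) <= d.-1 + d)%N.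
  move=> hG ht; apply: deg_adjmul => x; first by move=> /supp_qpoly; apply: cd.
  exact: hG.
case: hp => {s m n p} [s p hp|G j red hr|D S m hm|D S alpha t ht|D S alpha t ht|D S alpha|
    D S alpha zeta|G phis p hp] [_ _ ph] hd.
- by apply: rowd => x; apply: hd.
- have [hj [t [ht _ hx]]] := reduction_supp hle ph hr.
  apply: rowd => x /hx /(deglex_size hle) h; apply: leq_trans h _.
  by apply: (hd G`_j) => //; rewrite mem_nth.
- by apply: rowd => x; rewrite supp_mono => /eqP ->; apply: (cd' (gens D)).
- by apply: rowd => x /supp_qpoly; apply: cd'.
- by apply: d1; apply: qd.
- apply: d1; rewrite /Ppoly big_seq; apply: (big_ind (fun X => deg X <= d.-1 + d)%N).
  + by rewrite deg_zero.
  + by move=> X Y; apply: deg_add.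
  + move=> t ht; apply: deg_add; first exact: qd.
    rewrite addnC; apply: deg_adjmul => x; first exact: hd.
    by move=> /supp_qpoly; apply: cd.
- case: ph => _ hD _; apply: d1; apply/degP => i j w; rewrite -mcoeff_neq0 => nz.
  have : (i, j, w) \in star_products (monos D).
    by apply: contraNT nz => h; apply/eqP; apply: gram_supported h.
  move=> /allpairsP[[a b] [/= ha hb [_ _ ->]]]; rewrite [X in (X <= _)%N]size_sprod.
  by apply: leq_add; [apply: (cd (gens D))|apply: (cd' (gens D))] => //; apply: monos_chips.
- case: ph => _ _ _ hc; apply: rowd => x hx; apply: (cd' G) => //; exact: hc hx.
Qed.

End InvolvedDegree.

Theorem theorem1p4 (R : realType) (g l : nat) (le : rel (mono g l))
    (hle : is_deglex le) (iotas : seq 'rV[ncpoly R g]_l) :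
  [/\ forall d : nat, (0 < d)%N -> (forall p, p \in iotas -> (deg p <= d)%N) ->
        forall s, reachable le (Normalize iotas) s ->
        forall m n (p : 'M[ncpoly R g]_(m, n)), involved le s p ->
          (deg p < 2 * d)%N,
      terminates le (Normalize iotas) &
      forall G, reachable le (Normalize iotas) (Output G) ->
        reduced_left_gb le (real_radical (module_gen [set` iotas])) [set` G]].
Proof.
have init : run_inv le iotas (Normalize iotas).
  by apply: run_inv_reachable => //; apply: Relation_Operators.rt_refl.
have degs d s : (forall p, p \in iotas -> (deg p <= d)%N) ->
    reachable le (Normalize iotas) s -> deg_le d (basis s).
  move=> hd hs; have [] // : run_inv le iotas s /\ deg_le d (basis s).
  apply: (reachable_inv (P := fun s => run_inv le iotas s /\ deg_le d (basis s)) _ hs).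
    move=> s1 s2 st [inv h]; split; first exact: run_inv_step inv.
    exact: deg_le_step inv st h.
  by split=> // p m /hd /deg_rowP; apply.
split=> [d d0 hd s hs m n p hp||G].
- exact: (involved_deg hle d0 hp (run_inv_reachable hle hs) (degs _ _ hd hs)).
- split=> [|s hs]; last by exact: (step_exists (run_inv_reachable hle hs)).
  (* Termination is claimed without a given bound, so the largest degree of the generators serves as
     one. *)
  pose d := \max_(p <- iotas) deg p.
  apply: (no_infinite_run (d := d) hle init).
  apply: (degs d _ _ (Relation_Operators.rt_refl _ _ _)).
  by move=> p hp; rewrite /d (big_rem p) //= leq_maxl.
- exact: output_correct.
Qed.
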